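(* Let $\mathcal R$ be a unital ring and let $M$ be a right $\mathcal R$-module satisfying $Th(M)=Th(M)^{\aleph_0}$. Then $K_0(M)\cong\mathbb Z[\overline{\mathcal X}^*]$ as rings, where $\overline{\mathcal X}^*$ is the commutative monoid of colours of nonempty pp-sets of $M$. In particular, if $M$ is nonzero, then $K_0(M)$ is nontrivial (i.e. $0\ne1$ in $K_0(M)$).
   Context: **Definable sets and pp-sets.** A right $\mathcal R$-module $M$ is viewed as a first order structure in the language $\langle 0,+,-,m_r: r\in\mathcal R\rangle$, where $m_r$ is interpreted as right multiplication by $r$. ''Definable'' means definable with parameters from $M$. A pp-formula is a formula equivalent to one of the form $\exists y_1\dots\exists y_m\bigwedge_{i=1}^t\left(\sum_j x_jr_{ij}+\sum_k y_ks_{ik}+c_i=0\right)$ with $r_{ij},s_{ik}\in\mathcal R$ and parameters $c_i\in M$. A pp-set is a subset of some $M^n$ ($n\ge1$) defined by a pp-formula; it is either empty or a coset of a subgroup of $M^n$ defined by a parameter-free pp-formula (a pp-definable subgroup). **The condition $Th(M)=Th(M)^{\aleph_0}$** means $M\equiv M^{(\aleph_0)}$; equivalently $M\equiv M\oplus M$; equivalently, for every $n\ge1$ and all pp-definable subgroups $A,B$ of $M^n$, the index $[A:A\cap B]$ is either $1$ or infinite. **Grothendieck ring.** Two definable sets $A\subseteq M^n$, $B\subseteq M^m$ are definably isomorphic if there is a bijection $A\to B$ with definable graph; $[A]$ denotes the equivalence class. The set $\widetilde{\mathrm{Def}}(M)$ of all classes is a commutative semiring with $0=[\emptyset]$, $1=[\text{singleton}]$,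 $[A]+[B]=[A'\sqcup B']$ for disjoint $A'\in[A]$, $B'\in[B]$, and $[A]\cdot[B]=[A\times B]$. $K_0(M)$ is the Grothendieck ring of this semiring, i.e. the ring with the universal semiring homomorphism from $\widetilde{\mathrm{Def}}(M)$ to a commutative ring. **Colours.** For a nonempty pp-set $P$ (in any $M^n$) the colour $[[P]]$ is the set of all nonempty pp-sets $Q$ (in any $M^m$) for which there is a bijection $Q\to P$ whose graph is a pp-set. $\overline{\mathcal X}^*$ is the set of all colours of nonempty pp-sets; it is a commutative monoid under $[[A]]\star[[B]]:=[[A\times B]]$ with identity the colour $\mathfrak U$ of singletons. $\mathbb Z[\overline{\mathcal X}^*]$ is the integral monoid ring. *)

(* Defs.v *)
From HB Require Import structures.
From mathcomp Require Import all_boot all_order all_algebra.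
From mathcomp Require Import boolp classical_sets functions cardinality.
From mathcomp Require Import generic_quotient zify ring monalg.

Set Implicit Arguments.
Unset Strict Implicit.
Unset Printing Implicit Defensive.

Import GRing.Theory.
Local Open Scope classical_set_scope.
Local Open Scope quotient_scope.
Local Open Scope ring_scope.

(* A right R-module is a left module over the converse ring R^c. *)

Section Language.
Variable R : pzRingType.

Definition rscale (M : lmodType R^c) (x : M) (r : R) : M := (r : R^c) *: x.

(* Well-scoped terms and formulas of the language <0, +, -, m_r : r in R>: the
   free variables are the elements of 'I_n, and FEx binds the first of the n.+1
   variables of its body. *)
Inductive term (n : nat) : Type :=
| TVar of 'I_n
| TZero
| TAdd of term n & term n
| TOpp of term n
| TScale of term n & R.

Inductive formula (n : nat) : Type :=
| FEq of term n & term n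
| FNot of formula n
| FAnd of formula n & formula n
| FEx of formula n.+1.

Fixpoint eval (M : lmodType R^c) n (e : 'rV[M]_n) (t : term n) : M :=
  match t with
  | TVar i => e 0 i
  | TZero => 0
  | TAdd s t => eval e s + eval e t
  | TOpp t => - eval e t
  | TScale t r => rscale (eval e t) r
  end.

Fixpoint sat (M : lmodType R^c) n (phi : formula n) : 'rV[M]_n -> Prop :=
  match phi with
  | FEq s t => fun e => eval e s = eval e t
  | FNot p => fun e => ~ sat p e
  | FAnd p q => fun e => sat p e /\ sat q e
  | FEx p => fun e => exists a : M, sat p (row_mx (const_mx a : 'rV_1) e)
  end.

Definition elementarily_equivalent (M N : lmodType R^c) : Prop :=
  forall phi : formula 0, sat phi (0 : 'rV[M]_0) <-> sat phi (0 : 'rV[N]_0).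

End Language.
Arguments TZero {R n}.

Section DirectSum.
Variables (R : pzRingType) (M : lmodType R).

Definition fin_supported : {pred nat -> M} :=
  fun f => `[< finite_set [set i | f i <> 0] >].

Lemma fin_supported_submod : submod_closed fin_supported.
Proof.
split=> [|a f g /asboolP ff /asboolP fg]; apply/asboolP.
  by rewrite (_ : [set _ | _] = set0)//; apply/seteqP; split=> // i /=.
have fU : finite_set ([set i | f i <> 0] `|` [set i | g i <> 0]).
  by rewrite finite_setU.
apply: sub_finite_set fU => i /= h; apply: contrapT => /not_orP[].
move=> /contrapT f0 /contrapT g0; apply: h.
by change (a *: f i + g i = 0); rewrite f0 g0 scaler0 addr0.
Qed.

HB.instance Definition _ := GRing.isSubmodClosed.Build R (nat -> M)
  fin_supported fin_supported_submod.

(* the direct sum of aleph_0 copies of M *)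
Definition countable_copower := {f : nat -> M | f \in fin_supported}.
HB.instance Definition _ := SubChoice.on countable_copower.
HB.instance Definition _ := [SubChoice_isSubLmodule of countable_copower by <:].

End DirectSum.

Section Definability.
Variables (R : pzRingType) (M : lmodType R^c).

Definition definable n (X : set 'rV[M]_n) : Prop :=
  exists k (phi : formula R (n + k)) (c : 'rV[M]_k),
    X = [set x | sat phi (row_mx x c)].

(* The i-th columns of r and s, together with c 0 i, are the coefficients of the
   i-th equation; the entries of c are the parameters. *)
Definition pp_definable n (X : set 'rV[M]_n) : Prop :=
  exists m t (r : 'M[R]_(n, t)) (s : 'M[R]_(m, t)) (c : 'rV[M]_t),
    X = [set x | exists y : 'rV[M]_m, forall i : 'I_t,
      \sum_j rscale (x 0 j) (r j i) + \sum_k rscale (y 0 k) (s k i) + c 0 i = 0].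

Definition product_set n m (A : set 'rV[M]_n) (B : set 'rV[M]_m) :
    set 'rV[M]_(n + m) :=
  [set v | A (lsubmx v) /\ B (rsubmx v)].

(* With D := definable this is definable isomorphism; with D := pp_definable it
   asks for a bijection whose graph is a pp-set. Since M^m is never empty, every
   map A -> M^m is the restriction of a total one. *)
Definition isomorphic_in (D : forall n, set 'rV[M]_n -> Prop)
    n m (A : set 'rV[M]_n) (B : set 'rV[M]_m) : Prop :=
  exists f : 'rV[M]_n -> 'rV[M]_m,
    set_bij A B f /\ D (n + m)%N [set row_mx x (f x) | x in A].

End Definability.

Section Closure.
Variables (R : pzRingType) (M : lmodType R^c).

Record closed_class (D : forall n, set 'rV[M]_n -> Prop) : Prop := ClosedClass {
  ccI : forall n (X Y : set 'rV[M]_n), D n X -> D n Y -> D n (X `&` Y);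
  ccT : forall n, D n setT;
  cc_pre : forall n m (f : 'I_n -> 'I_m) (X : set 'rV[M]_n), D n X ->
    D m [set v : 'rV[M]_m | X (\row_i v 0 (f i))];
  cc_ex : forall n k (X : set 'rV[M]_(n + k)), D (n + k)%N X ->
    D n [set x : 'rV[M]_n | exists y : 'rV[M]_k, X (row_mx x y)];
  cc_eq : forall n (i j : 'I_n), D n [set v : 'rV[M]_n | v 0 i = v 0 j];
  cc_cst : forall n (i : 'I_n) (a : M), D n [set v : 'rV[M]_n | v 0 i = a] }.

Fixpoint ren_term n m (f : 'I_n -> 'I_m) (t : term R n) : term R m :=
  match t with
  | TVar i => TVar R (f i)
  | TZero => TZero
  | TAdd s t => TAdd (ren_term f s) (ren_term f t)
  | TOpp t => TOpp (ren_term f t)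
  | TScale t r => TScale (ren_term f t) r
  end.

Definition ren_lift n m (f : 'I_n -> 'I_m) (i : 'I_n.+1) : 'I_m.+1 :=
  match fintype.split (i : 'I_(1 + n)) with
  | inl j => lshift m j
  | inr j => rshift 1 (f j)
  end.

Fixpoint ren n m (f : 'I_n -> 'I_m) (phi : formula R n) : formula R m :=
  match phi with
  | FEq s t => FEq (ren_term f s) (ren_term f t)
  | FNot p => FNot (ren f p)
  | FAnd p q => FAnd (ren f p) (ren f q)
  | FEx p => FEx (ren (ren_lift f) p)
  end.

Lemma eval_ren n m (f : 'I_n -> 'I_m) t (e : 'rV[M]_m) :
  eval e (ren_term f t) = eval (\row_i e 0 (f i)) t.
Proof.
by elim: t => [i||s IHs t IHt|t IH|t IH r] /=; rewrite ?mxE ?IHs ?IHt ?IH.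
Qed.

Lemma ren_lift_env n m (f : 'I_n -> 'I_m) (a : 'rV[M]_1) (e : 'rV[M]_m) :
  \row_i (row_mx a e : 'rV_m.+1) 0 (ren_lift f i)
    = row_mx a (\row_i e 0 (f i)) :> 'rV_n.+1.
Proof.
apply/rowP => i; rewrite mxE /ren_lift [RHS]mxE.
case: fintype.split => j; first exact: (@row_mxEl _ 1 1 m).
by rewrite mxE; exact: (@row_mxEr _ 1 1 m).
Qed.

Lemma sat_ren n m (f : 'I_n -> 'I_m) phi (e : 'rV[M]_m) :
  sat (ren f phi) e <-> sat phi (\row_i e 0 (f i)).
Proof.
move: m f e; induction phi as [n s t|n p IH|n p IHp q IHq|n p IH] => m f e /=.
- by rewrite !eval_ren.
- by have := IH m f e; tauto.
- by have := IHp m f e; have := IHq m f e; tauto.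
- split=> -[a h]; exists a; first by have /IH := h; rewrite ren_lift_env.
  by apply/IH; rewrite ren_lift_env.
Qed.

Lemma definable_pre n m (f : 'I_n -> 'I_m) (X : set 'rV[M]_n) :
  definable X -> definable [set v : 'rV[M]_m | X (\row_i v 0 (f i))].
Proof.
move=> [k [phi [c ->]]].
exists k, (ren (fun i : 'I_(n + k) => match fintype.split i with
   inl j => lshift k (f j) | inr j => rshift m j end) phi), c.
have E (v : 'rV[M]_m) : \row_i row_mx v c 0 (match fintype.split i with
   inl j => lshift k (f j) | inr j => rshift m j end) = row_mx (\row_i v 0 (f i)) c.
  apply/rowP => i; rewrite mxE [RHS]mxE.
  by case: (fintype.split i) => j; rewrite !(row_mxEl,row_mxEr) ?mxE.
by apply/seteqP; split => v /=; rewrite sat_ren E.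
Qed.

Lemma definableC n (X : set 'rV[M]_n) : definable X -> definable (~` X).
Proof. by move=> [k [phi [c ->]]]; exists k, (FNot phi), c. Qed.

Lemma definableI n (X Y : set 'rV[M]_n) :
  definable X -> definable Y -> definable (X `&` Y).
Proof.
move=> [k [phi [c ->]]] [l [psi [d ->]]].
pose f (i : 'I_(n + k)) : 'I_(n + (k + l)) := match fintype.split i with
   inl j => lshift _ j | inr j => rshift n (lshift l j) end.
pose g (i : 'I_(n + l)) : 'I_(n + (k + l)) := match fintype.split i with
   inl j => lshift _ j | inr j => rshift n (rshift k j) end.
exists (k + l)%N, (FAnd (ren f phi) (ren g psi)), (row_mx c d).
have Ef (v : 'rV[M]_n) : \row_i row_mx v (row_mx c d) 0 (f i) = row_mx v c.
  apply/rowP => i; rewrite mxE [RHS]mxE /f.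
  by case: (fintype.split i) => j; rewrite !(row_mxEl,row_mxEr).
have Eg (v : 'rV[M]_n) : \row_i row_mx v (row_mx c d) 0 (g i) = row_mx v d.
  apply/rowP => i; rewrite mxE [RHS]mxE /g.
  by case: (fintype.split i) => j; rewrite !(row_mxEl,row_mxEr).
by apply/seteqP; split => v /=; rewrite !sat_ren Ef Eg.
Qed.

Lemma definable_eq n (i j : 'I_n) : definable [set v : 'rV[M]_n | v 0 i = v 0 j].
Proof.
exists 0%N, (FEq (TVar R (lshift 0 i)) (TVar R (lshift 0 j))), 0.
by apply/seteqP; split => v /=; rewrite !row_mxEl.
Qed.

Lemma definable_cst n (i : 'I_n) a : definable [set v : 'rV[M]_n | v 0 i = a].
Proof.
exists 1%N, (FEq (TVar R (lshift 1 i)) (TVar R (rshift n (0 : 'I_1)))), (const_mx a).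
by apply/seteqP; split => v /=; rewrite row_mxEl row_mxEr mxE.
Qed.

Lemma definableT n : definable [set: 'rV[M]_n].
Proof.
by exists 0%N, (FEq TZero TZero), 0; apply/seteqP; split => v.
Qed.

Lemma row_mx1A (a : 'rV[M]_1) n k (x : 'rV[M]_n) (c : 'rV[M]_k) :
  row_mx a (row_mx x c) = row_mx (row_mx a x) c :> 'rV_(n + k).+1.
Proof.
apply/rowP => i; rewrite !mxE.
case: splitP => j /= ij; case: splitP => l /= il.
- rewrite !mxE; case: splitP => j' /= jj.
    by congr (a 0 _); apply/val_inj; rewrite /= -jj -il ij.
  by move: (ltn_ord j); rewrite -ij il jj.
- by move: (ltn_ord j); rewrite -ij il.
- rewrite !mxE; case: splitP => j' /= jj; case: splitP => l' /= ll.
  + by move: (ltn_ord l'); rewrite -ll -il ij.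
  + congr (x 0 _); apply/val_inj => /=.
    by apply/eqP; rewrite -jj -(eqn_add2l 1) -ll -il ij.
  + by move: (ltn_ord l'); rewrite -ll -il ij.
  + by exfalso; move: (ltn_ord l'); rewrite -(ltn_add2l 1) -ll -il ij jj ltnNge /= leq_add2l leq_addr.
- rewrite !mxE; case: splitP => j' /= jj.
    by exfalso; move: (ltn_ord j'); rewrite -jj -(ltn_add2l 1) -ij il ltnNge leq_addr.
  congr (c 0 _); apply/val_inj => /=.
  by apply/eqP; rewrite -(eqn_add2l n) -jj -(eqn_add2l 1) -ij il addnA.
Qed.

Lemma definable_ex1 n (X : set 'rV[M]_n.+1) : definable X ->
  definable [set x : 'rV[M]_n | exists a : M, X (row_mx (const_mx a : 'rV_1) x)].
Proof.
move=> [k [phi [c ->]]]; exists k, (FEx (phi : formula R (n + k).+1)), c.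
by apply/seteqP; split => v /= [a h]; exists a; move: h; rewrite row_mx1A.
Qed.

Lemma definable_exl n k (X : set 'rV[M]_(k + n)) : definable X ->
  definable [set x : 'rV[M]_n | exists y : 'rV[M]_k, X (row_mx y x)].
Proof.
elim: k X => [|k IH] X dX.
  rewrite (_ : [set x | _] = X) //; apply/seteqP; split=> x /= => [[y]|Xx].
    by rewrite thinmx0 row_thin_mx.
  by exists 0; rewrite row_thin_mx.
have {}dX := definable_ex1 (dX : @definable R M (k + n).+1 X).
rewrite (_ : [set x | _] = [set x | exists y : 'rV_k, exists a : M,
   X (row_mx (const_mx a : 'rV_1) (row_mx y x))]); first exact: (IH _ dX).
apply/seteqP; split => x /= [y].
  move=> Xyx; exists (@rsubmx _ 1 1 k y), (y 0 0); rewrite row_mx1A.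
  suff -> : row_mx (const_mx (y 0 0)) (@rsubmx _ 1 1 k y) = y :> 'rV_(1 + k) by [].
  rewrite -[RHS](@hsubmxK _ 1 1 k); congr row_mx.
  apply/rowP => i; rewrite !mxE ord1; congr (y 0 _); exact/val_inj.
by move=> [a]; rewrite row_mx1A => h; exists (row_mx (const_mx a : 'rV_1) y).
Qed.

Definition ord_swap n k (i : 'I_(n + k)) : 'I_(k + n) :=
  match fintype.split i with inl j => rshift k j | inr j => lshift n j end.

Lemma row_swap n k (x : 'rV[M]_n) (y : 'rV[M]_k) :
  \row_i row_mx y x 0 (ord_swap i) = row_mx x y.
Proof.
apply/rowP => i; rewrite mxE [RHS]mxE /ord_swap.
by case: fintype.split => j; rewrite ?row_mxEl ?row_mxEr.
Qed.

Lemma definable_ex n k (X : set 'rV[M]_(n + k)) : definable X ->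
  definable [set x : 'rV[M]_n | exists y : 'rV[M]_k, X (row_mx x y)].
Proof.
move=> /(definable_pre (@ord_swap n k)) /definable_exl.
rewrite [X in definable X](_ : _ = [set x | exists y : 'rV_k, X (row_mx x y)])//.
by apply/seteqP; split=> x /= [y h]; exists y; move: h; rewrite row_swap.
Qed.

Lemma definable_closed : closed_class (@definable R M).
Proof.
split; [exact: definableI|exact: definableT|exact: definable_pre
  |exact: definable_ex|exact: definable_eq|exact: definable_cst].
Qed.

Lemma rscaleDr (x : M) (r s : R) : rscale x (r + s) = rscale x r + rscale x s.
Proof. exact: scalerDl. Qed.
Lemma rscaleN1 (x : M) : rscale x (- 1) = - x.
Proof. exact: scaleN1r. Qed.
Lemma rscale1 (x : M) : rscale x 1 = x.
Proof. exact: scale1r. Qed.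
Lemma rscale0 (x : M) : rscale x 0 = 0.
Proof. exact: scale0r. Qed.
Lemma rscale_sum I (s : seq I) (P : pred I) (x : M) (F : I -> R) :
  rscale x (\sum_(i <- s | P i) F i) = \sum_(i <- s | P i) rscale x (F i).
Proof.
apply: (big_morph (rscale x)); [exact: rscaleDr|exact: rscale0].
Qed.

Lemma ppT n : pp_definable [set: 'rV[M]_n].
Proof.
exists 0%N, 0%N, 0, 0, 0; apply/seteqP; split => v //= _.
by exists 0 => -[].
Qed.

Lemma mx0E p q i j : (0 : 'M[R]_(p, q)) i j = 0.
Proof. exact: mxE. Qed.

Lemma ppI n (X Y : set 'rV[M]_n) :
  pp_definable X -> pp_definable Y -> pp_definable (X `&` Y).
Proof.
move=> [m1 [t1 [r1 [s1 [c1 ->]]]]] [m2 [t2 [r2 [s2 [c2 ->]]]]].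
exists (m1 + m2)%N, (t1 + t2)%N, (row_mx r1 r2), (block_mx s1 0 0 s2), (row_mx c1 c2).
apply/seteqP; split => x /= => [[[y1 h1] [y2 h2]]|[y h]].
  exists (row_mx y1 y2) => i; rewrite -(splitK i); case: (fintype.split i) => j /=.
    rewrite row_mxEl; apply: etrans (h1 j); congr (_ + _ + _).
      by apply: eq_bigr => k _; rewrite row_mxEl.
    rewrite big_split_ord /= [X in _ + X]big1 ?addr0 => [|k _].
      by apply: eq_bigr => k _; rewrite row_mxEl block_mxEul.
    by rewrite block_mxEdl mx0E rscale0.
  rewrite row_mxEr; apply: etrans (h2 j); congr (_ + _ + _).
    by apply: eq_bigr => k _; rewrite row_mxEr.
  rewrite big_split_ord /= [X in X + _]big1 ?add0r => [|k _].
    by apply: eq_bigr => k _; rewrite row_mxEr block_mxEdr.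
  by rewrite block_mxEur mx0E rscale0.
split.
  exists (lsubmx y) => j; apply: etrans (h (lshift t2 j)); rewrite row_mxEl; congr (_ + _ + _).
    by apply: eq_bigr => k _; rewrite row_mxEl.
  rewrite big_split_ord /= [X in _ + X]big1 ?addr0 => [|k _].
    by apply: eq_bigr => k _; rewrite block_mxEul mxE.
  by rewrite block_mxEdl mx0E rscale0.
exists (rsubmx y) => j; apply: etrans (h (rshift t1 j)); rewrite row_mxEr; congr (_ + _ + _).
  by apply: eq_bigr => k _; rewrite row_mxEr.
rewrite big_split_ord /= [X in X + _]big1 ?add0r => [|k _].
  by apply: eq_bigr => k _; rewrite block_mxEdr mxE.
by rewrite block_mxEur mx0E rscale0.
Qed.

Lemma pp_pre n m (f : 'I_n -> 'I_m) (X : set 'rV[M]_n) :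
  pp_definable X -> pp_definable [set v : 'rV[M]_m | X (\row_i v 0 (f i))].
Proof.
move=> [p [t [r [s [c ->]]]]].
exists p, t, (\matrix_(j, i) \sum_(k | f k == j) r k i), s, c.
have E (x : 'rV[M]_m) i :
    \sum_j rscale (x 0 j) ((\matrix_(j, i) \sum_(k | f k == j) r k i) j i)
    = \sum_j rscale ((\row_i x 0 (f i)) 0 j) (r j i).
  rewrite [RHS](partition_big f xpredT) //=; apply: eq_bigr => j _.
  by rewrite mxE rscale_sum; apply: eq_bigr => k /eqP <-; rewrite mxE.
by apply/seteqP; split => x /= [y h]; exists y => i; move: (h i); rewrite E.
Qed.

Lemma pp_ex n k (X : set 'rV[M]_(n + k)) : pp_definable X ->
  pp_definable [set x : 'rV[M]_n | exists y : 'rV[M]_k, X (row_mx x y)].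
Proof.
move=> [p [t [r [s [c ->]]]]].
exists (k + p)%N, t, (usubmx r), (col_mx (dsubmx r) s), c.
have E (x : 'rV[M]_n) (y : 'rV[M]_k) (z : 'rV[M]_p) i :
    \sum_j rscale (row_mx x y 0 j) (r j i) + \sum_l rscale (z 0 l) (s l i)
    = \sum_j rscale (x 0 j) (usubmx r j i) +
      \sum_l rscale (row_mx y z 0 l) (col_mx (dsubmx r) s l i).
  rewrite !big_split_ord /= -!addrA; congr (_ + (_ + _)); apply: eq_bigr => l _;
  by rewrite ?row_mxEl ?row_mxEr ?col_mxEu ?col_mxEd ?mxE.
apply/seteqP; split => x /=.
  by move=> [y [z h]]; exists (row_mx y z) => i; rewrite -E.
move=> [y h]; exists (lsubmx y), (rsubmx y) => i.
by rewrite E hsubmxK.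
Qed.

Lemma pp_cst n (i : 'I_n) a : pp_definable [set v : 'rV[M]_n | v 0 i = a].
Proof.
exists 0%N, 1%N, (\matrix_(j, _) (j == i)%:R), 0, (const_mx (- a)).
have E (x : 'rV[M]_n) (k : 'I_1) :
    \sum_j rscale (x 0 j) ((\matrix_(j, _) (j == i)%:R) j k) = x 0 i.
  rewrite (bigD1 i) //= mxE eqxx rscale1 big1 ?addr0 // => j /negbTE ji.
  by rewrite mxE ji rscale0.
apply/seteqP; split => x /=.
  by move=> h; exists 0 => k; rewrite E h big_ord0 addr0 mxE subrr.
by move=> [y /(_ 0)]; rewrite E big_ord0 addr0 mxE => /eqP; rewrite subr_eq0 => /eqP.
Qed.

Lemma pp_eq n (i j : 'I_n) : pp_definable [set v : 'rV[M]_n | v 0 i = v 0 j].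
Proof.
exists 0%N, 1%N, (\matrix_(k, _) ((k == i)%:R + (-1) * (k == j)%:R)), 0, 0.
have E (x : 'rV[M]_n) (k : 'I_1) :
    \sum_l rscale (x 0 l) ((\matrix_(l, _) ((l == i)%:R + (-1) * (l == j)%:R)) l k)
    = x 0 i - x 0 j.
  under eq_bigr do rewrite mxE rscaleDr.
  rewrite big_split /= (bigD1 i) //= eqxx rscale1 big1 ?addr0 => [|l /negbTE->].
    rewrite (bigD1 j) //= eqxx mulr1 rscaleN1 big1 ?addr0 => [|l /negbTE->] //.
    by rewrite mulr0 rscale0.
  by rewrite rscale0.
apply/seteqP; split => x /=.
  by move=> h; exists 0 => k; rewrite E h big_ord0 !addr0 subrr mxE add0r.
move=> [y /(_ 0)]; rewrite E big_ord0 addr0 mxE addr0 => /eqP.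
by rewrite subr_eq0 => /eqP.
Qed.

Lemma pp_closed : closed_class (@pp_definable R M).
Proof.
split; [exact: ppI|exact: ppT|exact: pp_pre|exact: pp_ex|exact: pp_eq|exact: pp_cst].
Qed.

End Closure.

Section ClosureTheory.
Variables (R : pzRingType) (M : lmodType R^c).
Variables (D : forall n, set 'rV[M]_n -> Prop) (Dc : closed_class D).

Lemma cc_ext n (X Y : set 'rV[M]_n) : (forall v, X v <-> Y v) -> D X -> D Y.
Proof. by move=> h; rewrite (_ : Y = X)//; apply/seteqP; split=> v /h. Qed.

Lemma cc_sub n m (f : 'I_n -> 'I_m) (g : 'rV[M]_m -> 'rV[M]_n)
    (X : set 'rV[M]_n) : (forall v i, g v 0 i = v 0 (f i)) -> D X ->
  D [set v | X (g v)].
Proof.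
move=> fg /(cc_pre Dc f); apply: cc_ext => v /=.
by rewrite (_ : \row_i _ = g v)//; apply/rowP => i; rewrite mxE.
Qed.

Lemma cc_sub2 n1 n2 m (f1 : 'I_n1 -> 'I_m) (f2 : 'I_n2 -> 'I_m)
    (g1 : 'rV[M]_m -> 'rV[M]_n1) (g2 : 'rV[M]_m -> 'rV[M]_n2)
    (X : set 'rV[M]_(n1 + n2)) :
  (forall v i, g1 v 0 i = v 0 (f1 i)) -> (forall v i, g2 v 0 i = v 0 (f2 i)) ->
  D X -> D [set v | X (row_mx (g1 v) (g2 v))].
Proof.
move=> h1 h2; apply: (@cc_sub _ _ (fun i => match fintype.split i with
  inl j => f1 j | inr j => f2 j end)) => v i; rewrite mxE.
by case: (fintype.split i).
Qed.

Lemma cc_and n (X Y : set 'rV[M]_n) : D X -> D Y -> D [set v | X v /\ Y v].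
Proof. exact: ccI. Qed.

Lemma cc_forall (I : finType) n (X : I -> set 'rV[M]_n) :
  (forall i, D (X i)) -> D [set v | forall i, X i v].
Proof.
move=> h; suff: forall s : seq I, D [set v | forall i, i \in s -> X i v].
  move/(_ (enum I)); apply: cc_ext => v /=; split=> H i; last by move=> _.
  by apply: H; rewrite mem_enum.
elim=> [|i s IH]; first by apply: cc_ext (ccT Dc n).
apply: cc_ext (cc_and (h i) IH) => v /=; split.
  by move=> [Hi Hs] j; rewrite inE => /orP[/eqP->//|/Hs].
by move=> H; split=> [|j js]; apply: H; rewrite inE ?eqxx ?js ?orbT.
Qed.

Lemma cc_eqv n m (f g : 'I_n -> 'I_m) (h k : 'rV[M]_m -> 'rV[M]_n) :
  (forall v i, h v 0 i = v 0 (f i)) -> (forall v i, k v 0 i = v 0 (g i)) ->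
  D [set v | h v = k v].
Proof.
move=> hf kg; apply: cc_ext (cc_forall (fun i => cc_eq Dc (f i) (g i))) => v /=.
split=> [H|H i]; first by apply/rowP => i; rewrite hf kg.
by rewrite -hf -kg H.
Qed.

Lemma cc_point n (a : 'rV[M]_n) : D [set a].
Proof.
apply: cc_ext (cc_forall (fun i => cc_cst Dc i (a 0 i))) => v /=.
by split=> [H|-> //]; apply/rowP.
Qed.

Lemma lsubE n m (v : 'rV[M]_(n + m)) i : lsubmx v 0 i = v 0 (lshift m i).
Proof. by rewrite mxE. Qed.
Lemma rsubE n m (v : 'rV[M]_(n + m)) i : rsubmx v 0 i = v 0 (rshift n i).
Proof. by rewrite mxE. Qed.
Lemma lsub2E n m p (v : 'rV[M]_(n + m + p)) i :
  lsubmx (lsubmx v) 0 i = v 0 (lshift p (lshift m i)).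
Proof. by rewrite !mxE. Qed.
Lemma rlsubE n m p (v : 'rV[M]_(n + m + p)) i :
  rsubmx (lsubmx v) 0 i = v 0 (lshift p (rshift n i)).
Proof. by rewrite !mxE. Qed.
Lemma rsub2E n m p (v : 'rV[M]_(n + (m + p))) i :
  rsubmx (rsubmx v) 0 i = v 0 (rshift n (rshift m i)).
Proof. by rewrite !mxE. Qed.
Lemma lrsubE n m p (v : 'rV[M]_(n + (m + p))) i :
  lsubmx (rsubmx v) 0 i = v 0 (rshift n (lshift p i)).
Proof. by rewrite !mxE. Qed.

Lemma cc_lsub n m (X : set 'rV[M]_n) : D X -> D [set v : 'rV[M]_(n + m) | X (lsubmx v)].
Proof. exact: cc_sub (@lsubE n m). Qed.
Lemma cc_rsub n m (X : set 'rV[M]_m) : D X -> D [set v : 'rV[M]_(n + m) | X (rsubmx v)].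
Proof. exact: cc_sub (@rsubE n m). Qed.

Lemma cc_product n m (A : set 'rV[M]_n) (B : set 'rV[M]_m) :
  D A -> D B -> D (product_set A B).
Proof. by move=> dA dB; apply: cc_and; [exact: cc_lsub|exact: cc_rsub]. Qed.

Lemma cc_comp n m p (G : set 'rV[M]_(n + m)) (H : set 'rV[M]_(m + p)) :
  D G -> D H -> D [set v : 'rV[M]_(n + p) | exists y,
     G (row_mx (lsubmx v) y) /\ H (row_mx y (rsubmx v))].
Proof.
move=> dG dH.
have d : D [set w : 'rV[M]_(n + p + m) |
    G (row_mx (lsubmx (lsubmx w)) (rsubmx w)) /\
    H (row_mx (rsubmx w) (rsubmx (lsubmx w)))].
  by apply: cc_and; [exact: (cc_sub2 (@lsub2E n p m) (@rsubE _ m))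
                    |exact: (cc_sub2 (@rsubE _ m) (@rlsubE n p m))].
apply: cc_ext (cc_ex Dc d) => v /=.
by split=> -[y h]; exists y; move: h; rewrite !row_mxKl !row_mxKr.
Qed.

Lemma cc_prodrel n m n' m' (G : set 'rV[M]_(n + m)) (H : set 'rV[M]_(n' + m')) :
  D G -> D H -> D [set v : 'rV[M]_((n + n') + (m + m')) |
     G (row_mx (lsubmx (lsubmx v)) (lsubmx (rsubmx v))) /\
     H (row_mx (rsubmx (lsubmx v)) (rsubmx (rsubmx v)))].
Proof.
by move=> dG dH; apply: cc_and;
 [exact: (cc_sub2 (@lsub2E _ _ _) (@lrsubE _ _ _))
 |exact: (cc_sub2 (@rlsubE _ _ _) (@rsub2E _ _ _))].
Qed.

Lemma isoP n m (A : set 'rV[M]_n) (B : set 'rV[M]_m) :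
  isomorphic_in D A B <-> exists G : 'rV[M]_n -> 'rV[M]_m -> Prop,
  [/\ D [set v | G (lsubmx v) (rsubmx v)],
      forall x y, G x y -> A x /\ B y,
      (forall x, A x -> exists y, G x y) /\ (forall y, B y -> exists x, G x y),
      forall x y y', G x y -> G x y' -> y = y' &
      forall x x' y, G x y -> G x' y -> x = x'].
Proof.
split.
  move=> [f [[fAB fI fS] dG]]; exists (fun x y => A x /\ f x = y); split.
  - apply: cc_ext dG => v /=; split=> [[x Ax <-]|[Av fv]].
      by rewrite row_mxKl row_mxKr.
    by exists (lsubmx v); rewrite ?fv ?hsubmxK.
  - by move=> x y [Ax <-]; split=> //; apply: fAB.
  - split=> [x Ax|y /fS[x Ax fx]]; first by exists (f x).
    by exists x.
  - by move=> x y y' [_ <-] [].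
  - by move=> x x' y [Ax <-] [Ax' /esym]; apply: fI; rewrite inE.
move=> [G [dG GAB [GA GB] Gf Gi]].
have [f fP] : {f : 'rV[M]_n -> 'rV[M]_m | forall x, A x -> G x (f x)}.
  have h x : exists y, A x -> G x y.
    have [Ax|nA] := pselect (A x); last by exists 0.
    by have [y Gy] := GA _ Ax; exists y.
  by exists (fun x => projT1 (cid (h x))) => x; case: cid.
exists f; split; last first.
  apply: cc_ext dG => v /=; split=> [Gv|[x Ax <-]].
    have [Av _] := GAB _ _ Gv; exists (lsubmx v) => //.
    by rewrite (Gf _ _ _ (fP _ Av) Gv) hsubmxK.
  by rewrite row_mxKl row_mxKr; exact: fP.
split.
- by move=> x /fP /GAB[].
- move=> x x' /set_mem Ax /set_mem Ax' ff; apply: Gi (fP _ Ax) _.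
  by rewrite ff; exact: fP.
- move=> y By; have [x Gx] := GB _ By; have [Ax _] := GAB _ _ Gx.
  by exists x => //; exact: Gf (fP _ Ax) Gx.
Qed.

Lemma iso_refl n (A : set 'rV[M]_n) : D A -> isomorphic_in D A A.
Proof.
move=> dA; apply/isoP; exists (fun x y => A x /\ x = y); split.
- by apply: cc_and; [exact: cc_lsub|exact: cc_eqv (@lsubE _ _) (@rsubE _ _)].
- by move=> x y [Ax <-].
- by split=> x Ax; exists x.
- by move=> x y y' [_ <-] [].
- by move=> x x' y [_ ->] [].
Qed.

Lemma iso_sym n m (A : set 'rV[M]_n) (B : set 'rV[M]_m) :
  isomorphic_in D A B -> isomorphic_in D B A.
Proof.
move=> /isoP[G [dG GAB [GA GB] Gf Gi]]; apply/isoP; exists (fun x y => G y x).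
split; [|by move=> x y /GAB[]|by split|by move=> x y y' ? ?; apply: Gi; eauto
  |by move=> x y y' ? ?; apply: Gf; eauto].
apply: cc_ext (cc_sub2 (@rsubE m n) (@lsubE m n) dG) => v /=.
by rewrite row_mxKl row_mxKr.
Qed.

Lemma iso_trans n m p (A : set 'rV[M]_n) (B : set 'rV[M]_m) (C : set 'rV[M]_p) :
  isomorphic_in D A B -> isomorphic_in D B C -> isomorphic_in D A C.
Proof.
move=> /isoP[G [dG GAB [GA GB] Gf Gi]] /isoP[H [dH HBC [HB HC] Hf Hi]].
apply/isoP; exists (fun x z => exists y, G x y /\ H y z); split.
- apply: cc_ext (cc_comp dG dH) => v /=.
  by split=> -[y h]; exists y; move: h; rewrite !row_mxKl !row_mxKr.
- by move=> x z [y [/GAB[? _] /HBC[]]].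
- split=> [x /GA[y Gy]|z /HC[y Hy]].
    by have [z Hz] := HB _ (GAB _ _ Gy).2; exists z, y.
  by have [x Gx] := GB _ (HBC _ _ Hy).1; exists x, y.
- move=> x z z' [y [Gy Hz]] [y' [Gy' Hz']].
  by rewrite -(Gf _ _ _ Gy Gy') in Hz'; exact: Hf Hz Hz'.
- move=> x x' z [y [Gy Hz]] [y' [Gy' Hz']].
  by rewrite -(Hi _ _ _ Hz Hz') in Gy'; exact: Gi Gy Gy'.
Qed.

Lemma iso_product n m n' m' (A : set 'rV[M]_n) (B : set 'rV[M]_m)
    (A' : set 'rV[M]_n') (B' : set 'rV[M]_m') :
  isomorphic_in D A B -> isomorphic_in D A' B' ->
  isomorphic_in D (product_set A A') (product_set B B').
Proof.
move=> /isoP[G [dG GAB [GA GB] Gf Gi]] /isoP[H [dH HAB [HA HB] Hf Hi]].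
apply/isoP; exists (fun x y => G (lsubmx x) (lsubmx y) /\ H (rsubmx x) (rsubmx y)).
split.
- apply: cc_ext (cc_prodrel dG dH) => v /=.
  by rewrite !row_mxKl !row_mxKr.
- by move=> x y [/GAB[? ?] /HAB[? ?]].
- split=> [x [/GA[y Gy] /HA[z Hz]]|x [/GB[y Gy] /HB[z Hz]]].
    by exists (row_mx y z); rewrite row_mxKl row_mxKr.
  by exists (row_mx y z); rewrite row_mxKl row_mxKr.
- move=> x y y' [G1 H1] [G2 H2].
  by rewrite -[y]hsubmxK -[y']hsubmxK (Gf _ _ _ G1 G2) (Hf _ _ _ H1 H2).
- move=> x y y' [G1 H1] [G2 H2].
  by rewrite -[x]hsubmxK -[y]hsubmxK (Gi _ _ _ G1 G2) (Hi _ _ _ H1 H2).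
Qed.

Lemma iso_coord n m (A : set 'rV[M]_n) (B : set 'rV[M]_m)
    (f : 'I_n -> 'I_m) (g : 'I_m -> 'I_n) :
  cancel f g -> cancel g f -> D A ->
  (forall v : 'rV[M]_m, B v <-> A (\row_i v 0 (f i))) -> isomorphic_in D A B.
Proof.
move=> fK gK dA BA.
apply/isoP; exists (fun x y => A x /\ x = \row_i y 0 (f i)); split.
- apply: cc_and; first exact: cc_lsub.
  apply: (cc_eqv (f := lshift m) (g := fun i => rshift n (f i))) => v i.
    exact: lsubE.
  by rewrite !mxE.
- by move=> x y [Ax E]; split=> //; rewrite BA -E.
- split=> [x Ax|y By].
    exists (\row_j x 0 (g j)); split=> //.
    by apply/rowP => i; rewrite !mxE fK.
  by exists (\row_i y 0 (f i)); split=> //; rewrite -BA.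
- move=> x y y' [_ ->] [_ /rowP E]; apply/rowP => j.
  by move: (E (g j)); rewrite !mxE gK.
- by move=> x x' y [_ ->] [_ ->].
Qed.

Lemma ord_swapK n k : cancel (@ord_swap n k) (@ord_swap k n).
Proof.
move=> i; rewrite /ord_swap -[RHS](splitK i).
case: (fintype.split i) => j /=.
  by rewrite (unsplitK (inr _ j)).
by rewrite (unsplitK (inl _ j)).
Qed.

Lemma row_cast n m p (v : 'rV[M]_(n + (m + p))) :
  \row_i v 0 (cast_ord (esym (addnA n m p)) i) =
  row_mx (row_mx (lsubmx v) (lsubmx (rsubmx v))) (rsubmx (rsubmx v)).
Proof.
apply/rowP => i; rewrite mxE [RHS]mxE; case: (splitP i) => j ij; last first.
  by rewrite rsub2E; congr (v 0 _); apply/val_inj => /=; lia.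
rewrite mxE; case: (splitP j) => k jk.
  by rewrite lsubE; congr (v 0 _); apply/val_inj => /=; lia.
by rewrite lrsubE; congr (v 0 _); apply/val_inj => /=; lia.
Qed.

Lemma iso_productC n m (A : set 'rV[M]_n) (B : set 'rV[M]_m) : D A -> D B ->
  isomorphic_in D (product_set A B) (product_set B A).
Proof.
move=> dA dB; apply: (iso_coord (f := @ord_swap _ _) (g := @ord_swap _ _)).
- exact: ord_swapK.
- exact: ord_swapK.
- exact: cc_product.
- move=> v; rewrite -[v]hsubmxK row_swap /product_set /=.
  by rewrite !row_mxKl !row_mxKr; tauto.
Qed.

Lemma iso_productA n m p (A : set 'rV[M]_n) (B : set 'rV[M]_m)
    (C : set 'rV[M]_p) : D A -> D B -> D C ->
  isomorphic_in D (product_set A (product_set B C))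
                  (product_set (product_set A B) C).
Proof.
move=> dA dB dC; apply: iso_sym.
apply: (iso_coord (f := cast_ord (esym (addnA _ _ _)))
   (g := cast_ord (addnA _ _ _))).
- exact: cast_ordKV.
- exact: cast_ordK.
- by apply: cc_product => //; exact: cc_product.
- move=> v; rewrite row_cast /product_set /=.
  by rewrite !row_mxKl !row_mxKr; tauto.
Qed.

Lemma iso_product1 n k (a : 'rV[M]_k) (A : set 'rV[M]_n) : D A ->
  isomorphic_in D (product_set [set a] A) A.
Proof.
move=> dA; apply/isoP.
exists (fun x y => A y /\ x = row_mx a y); split.
- apply: (cc_ext (X := [set v | A (rsubmx v) /\
      ([set a] (lsubmx (lsubmx v)) /\ rsubmx (lsubmx v) = rsubmx v)])).
    move=> v /=; split=> [[Av [v1 v2]]|[Av ->]].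
      by rewrite -[lsubmx v]hsubmxK v1 v2.
    by rewrite row_mxKl row_mxKr.
  apply: cc_and; first exact: cc_rsub.
  apply: cc_and; last exact: (cc_eqv (@rlsubE _ _ _) (@rsubE _ _)).
  exact: (cc_sub (@lsub2E _ _ _) (cc_point a)).
- move=> x y [Ay ->]; rewrite /product_set /= row_mxKl row_mxKr.
  by split.
- split=> [x [/= x0 Ax]|y Ay].
    by exists (rsubmx x); split; rewrite // -x0 hsubmxK.
  by exists (row_mx a y).
- by move=> x y y' [_ ->] [_ /eq_row_mx[]].
- by move=> x x' y [_ ->] [_ ->].
Qed.

Lemma iso_product1r n k (a : 'rV[M]_k) (A : set 'rV[M]_n) : D A ->
  isomorphic_in D (product_set A [set a]) A.
Proof.
move=> dA; apply: iso_trans (iso_product1 a dA).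
by apply: iso_productC => //; exact: cc_point.
Qed.

Lemma iso_point n m (A : set 'rV[M]_n) a (b : 'rV[M]_m) : A = [set a] ->
  isomorphic_in D A [set b].
Proof.
move=> ->; apply/isoP.
exists (fun x y => x = a /\ y = b); split.
- have h1 := @cc_lsub n m _ (cc_point a).
  have h2 := @cc_rsub n m _ (cc_point b).
  exact: (cc_and h1 h2).
- by move=> x y [-> ->].
- by split=> [x ->|x ->]; [exists b|exists a].
- by move=> x y y' [_ ->] [_ ->].
- by move=> x y y' [-> _] [-> _].
Qed.

End ClosureTheory.

Section Colours.
Variables (R : pzRingType) (M : lmodType R^c).

Record ppset := PpSet {
  pp_dim : nat;
  pp_carrier :> set 'rV[M]_pp_dim;
  pp_dim_gt0 : (0 < pp_dim)%N;
  pp_carrier_neq0 : pp_carrier !=set0;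
  pp_carrierP : pp_definable pp_carrier }.

#[global] Arguments pp_carrier _ _ : clear implicits.

HB.instance Definition _ := gen_eqMixin ppset.
HB.instance Definition _ := gen_choiceMixin ppset.

Definition same_colour (P Q : ppset) : bool :=
  `[< isomorphic_in (@pp_definable R M) Q P >].

Lemma same_colourP (P Q : ppset) : reflect (isomorphic_in (@pp_definable R M) P Q)
  (same_colour P Q).
Proof.
by apply: (iffP (asboolP _)) => /(iso_sym (pp_closed M)).
Qed.

Lemma same_colour_refl : reflexive same_colour.
Proof.
by move=> P; apply/same_colourP/(iso_refl (pp_closed M))/pp_carrierP.
Qed.

Lemma same_colour_sym : symmetric same_colour.
Proof.
move=> P Q; apply/same_colourP/same_colourP; exact: (iso_sym (pp_closed M)).
Qed.

Lemma same_colour_trans : transitive same_colour.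
Proof.
move=> Q P S /same_colourP PQ /same_colourP QS; apply/same_colourP.
exact: (iso_trans (pp_closed M)) PQ QS.
Qed.

Canonical same_colour_equiv :=
  EquivRel same_colour same_colour_refl same_colour_sym same_colour_trans.

(* The quotient presents the colour [[P]], which is the same_colour-class of P. *)
Definition colour := {eq_quot same_colour}.
HB.instance Definition _ := Choice.on colour.

Definition colour_of (P : ppset) : colour := \pi_colour%qT P.

Lemma colour_ofP (P Q : ppset) :
  colour_of P = colour_of Q <-> isomorphic_in (@pp_definable R M) P Q.
Proof.
by split=> [/eqmodP/same_colourP//|h]; apply/eqmodP/same_colourP.
Qed.

Lemma colourW (T : colour -> Prop) : (forall P, T (colour_of P)) -> forall c, T c.
Proof. exact: quotW. Qed.

Lemma ppsingle_subproof : pp_definable [set (0 : 'rV[M]_1)].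
Proof. exact: (cc_point (pp_closed M)). Qed.

Definition ppsingle : ppset :=
  PpSet (isT : 0 < 1)%N (ex_intro _ 0 erefl) ppsingle_subproof.

Lemma ppprod_gt0 (P Q : ppset) : (0 < pp_dim P + pp_dim Q)%N.
Proof. by rewrite addn_gt0 pp_dim_gt0. Qed.

Lemma ppprod_neq0 (P Q : ppset) : product_set P Q !=set0.
Proof.
have [[x Px] [y Qy]] := (pp_carrier_neq0 P, pp_carrier_neq0 Q).
by exists (row_mx x y); rewrite /product_set /= row_mxKl row_mxKr.
Qed.

Definition ppprod (P Q : ppset) : ppset := PpSet (ppprod_gt0 P Q)
  (ppprod_neq0 P Q) (cc_product (pp_closed M) (pp_carrierP P) (pp_carrierP Q)).

Definition colour_one : colour := colour_of ppsingle.
Definition colour_mul (c d : colour) : colour :=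
  colour_of (ppprod (repr c) (repr d)).

Lemma colour_mulE P Q : colour_mul (colour_of P) (colour_of Q) = colour_of (ppprod P Q).
Proof.
by apply/colour_ofP/(iso_product (pp_closed M)); apply/colour_ofP; exact: reprK.
Qed.

Lemma colour_mulA : associative colour_mul.
Proof.
elim/colourW=> P; elim/colourW=> Q; elim/colourW=> S; rewrite !colour_mulE.
apply/colour_ofP/(iso_productA (pp_closed M)); exact: pp_carrierP.
Qed.

Lemma colour_mulC : commutative colour_mul.
Proof.
elim/colourW=> P; elim/colourW=> Q; rewrite !colour_mulE.
apply/colour_ofP/(iso_productC (pp_closed M)); exact: pp_carrierP.
Qed.

Lemma colour_mul1 : left_id colour_one colour_mul.
Proof.
elim/colourW=> P; rewrite colour_mulE; apply/colour_ofP/(iso_product1 (pp_closed M)); exact: pp_carrierP.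
Qed.

Lemma colour_mulr1 : right_id colour_one colour_mul.
Proof. by move=> c; rewrite colour_mulC colour_mul1. Qed.

Lemma colour_unitm (c d : colour) :
  colour_mul c d = colour_one -> c = colour_one /\ d = colour_one.
Proof.
elim/colourW: c => P; elim/colourW: d => Q.
rewrite colour_mulE => /colour_ofP[f [[fT fI _] _]].
have inj u v : pp_carrier (ppprod P Q) u -> pp_carrier (ppprod P Q) v -> u = v.
  by move=> hu hv; apply: fI; rewrite ?inE //; rewrite (fT u hu) (fT v hv).
have [[p Pp] [q Qq]] := (pp_carrier_neq0 P, pp_carrier_neq0 Q).
have h x y : pp_carrier P x -> pp_carrier Q y ->
    pp_carrier (ppprod P Q) (row_mx x y).
  by rewrite /= /product_set /= row_mxKl row_mxKr.
split; apply/colour_ofP.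
  apply: (@iso_point _ _ _ (pp_closed M) _ _ _ p); apply/seteqP; split => [x Px|x -> //].
  by have /eq_row_mx[] := inj _ _ (h _ _ Px Qq) (h _ _ Pp Qq).
apply: (@iso_point _ _ _ (pp_closed M) _ _ _ q); apply/seteqP; split => [x Px|x -> //].
by have /eq_row_mx[] := inj _ _ (h _ _ Pp Px) (h _ _ Pp Qq).
Qed.

(* monalg only forms monoid rings over monoids in which a product is 1 only when
   both factors are; here the product of two nonempty sets is a singleton only
   when both are. *)
HB.instance Definition _ := Choice_isMonomialDef.Build colour
  colour_mulA colour_mul1 colour_mulr1 colour_unitm.
HB.instance Definition _ := MonomialDef_isConomialDef.Build colour colour_mulC.

End Colours.

Section DefinableSets.
Variables (R : pzRingType) (M : lmodType R^c).

Record defset := DefSet {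
  def_dim : nat;
  def_carrier :> set 'rV[M]_def_dim;
  def_dim_gt0 : (0 < def_dim)%N;
  def_carrierP : definable def_carrier }.
#[global] Arguments def_carrier _ _ : clear implicits.

Definition defset_iso (A B : defset) : Prop :=
  isomorphic_in (@definable R M) A B.

Let Dc := definable_closed M.

Lemma defset_iso_refl A : defset_iso A A.
Proof. exact/(iso_refl Dc)/def_carrierP. Qed.

Lemma defprod_gt0 (A B : defset) : (0 < def_dim A + def_dim B)%N.
Proof. by rewrite addn_gt0 def_dim_gt0. Qed.

Definition defprod (A B : defset) : defset := DefSet (defprod_gt0 A B)
  (cc_product Dc (def_carrierP A) (def_carrierP B)).

Definition defpoint n (n_gt0 : (0 < n)%N) (a : 'rV[M]_n) : defset :=
  DefSet n_gt0 (cc_point Dc a).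

Definition defsingle : defset := defpoint (isT : 0 < 1)%N 0.

Lemma definable_set0 n : definable (@set0 'rV[M]_n).
Proof. by rewrite -setCT; exact/definableC/definableT. Qed.

Definition defset0 : defset := DefSet (isT : 0 < 1)%N (definable_set0 1).

Lemma definableU n (X Y : set 'rV[M]_n) :
  definable X -> definable Y -> definable (X `|` Y).
Proof.
by move=> dX dY; rewrite -[_ `|` _]setCK setCU; apply: definableC;
   apply: definableI; apply: definableC.
Qed.

Lemma definable_bigU (I : finType) n (X : I -> set 'rV[M]_n) :
  (forall i, definable (X i)) -> definable [set v | exists i, X i v].
Proof.
move=> dX.
have /definableC := cc_forall Dc (fun i => definableC (dX i)).
apply: (cc_ext (D := @definable R M)) => v /=; split=> [h|[i Xi] h].
  by apply: contrapT => /forallNP h'; apply: h.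
exact: h i Xi.
Qed.

(* A family (A i)_i of definable sets stands for the tagged union of the A i. A
   bijection of tagged unions is definable when all its pieces are, the (i, j)
   piece being the part of its graph that lies in A i x B j. *)
Definition points (I : Type) (A : I -> defset) : set {i : I & 'rV[M]_(def_dim (A i))} :=
  [set p | def_carrier (A (tag p)) (tagged p)].

#[global] Arguments points {I} A _.

Definition family_iso (I J : Type) (A : I -> defset) (B : J -> defset) : Prop :=
  exists f : points A -> points B, bijective f /\
    forall i j, definable [set v : 'rV[M]_(def_dim (A i) + def_dim (B j)) |
      exists2 p : points A, val p = existT _ i (lsubmx v) &
                            val (f p) = existT _ j (rsubmx v)].

Lemma family_isoP (I J : Type) (A : I -> defset) (B : J -> defset) :
  family_iso A B <-> exists G : forall (i : I) (j : J),
    'rV[M]_(def_dim (A i)) -> 'rV[M]_(def_dim (B j)) -> Prop,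
  [/\ forall i j, definable [set v | G i j (lsubmx v) (rsubmx v)],
      forall i j x y, G i j x y -> def_carrier (A i) x /\ def_carrier (B j) y,
      (forall i x, def_carrier (A i) x -> exists j y, G i j x y) /\
      (forall j y, def_carrier (B j) y -> exists i x, G i j x y),
      forall i j j' x y y', G i j x y -> G i j' x y' ->
        existT (fun j => 'rV[M]_(def_dim (B j))) j y = existT _ j' y' &
      forall i i' j x x' y, G i j x y -> G i' j x' y ->
        existT (fun i => 'rV[M]_(def_dim (A i))) i x = existT _ i' x'].
Proof.
split.
  move=> [f [[g fK gK] df]].
  exists (fun i j x y => exists2 p : points A, val p = existT _ i x &
                            val (f p) = existT _ j y); split => //.
  - move=> i j x y [p pE fpE].
    by have := set_valP p; have := set_valP (f p); rewrite /set_val /= pE fpE.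
  - split=> [i x Ax|j y By].
      have px : existT _ i x \in points A by rewrite inE.
      case E : (val (f (SigSub px))) => [j y].
      by exists j, y, (SigSub px).
    have py : existT _ j y \in points B by rewrite inE.
    case E : (val (g (SigSub py))) => [i x].
    by exists i, x, (g (SigSub py)); rewrite ?gK.
  - by move=> i j j' x y y' [p pE <-] [p' pE' <-]; congr (val (f _));
      apply: val_inj; rewrite pE pE'.
  - move=> i i' j x x' y [p <- fE] [p' <- fE']; congr (val _).
    by apply: (can_inj fK); apply: val_inj; rewrite fE fE'.
move=> [G [dG GAB [GA GB] Gf Gi]].
pose H (p : points A) (q : points B) :=
  G (tag (val p)) (tag (val q)) (tagged (val p)) (tagged (val q)).
have Hf p : exists q, H p q.
  have [j [y Gy]] := GA _ _ (set_valP p).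
  have qy : existT _ j y \in points B by rewrite inE; have [] := GAB _ _ _ _ Gy.
  by exists (SigSub qy).
have Hg q : exists p, H p q.
  have [i [x Gx]] := GB _ _ (set_valP q).
  have px : existT _ i x \in points A by rewrite inE; have [] := GAB _ _ _ _ Gx.
  by exists (SigSub px).
have Hfun p q q' : H p q -> H p q' -> q = q'.
  move=> h h'; apply: val_inj; move: (Gf _ _ _ _ _ _ h h').
  by case: (val q) (val q') => ? ? [].
have Hinj p p' q : H p q -> H p' q -> p = p'.
  move=> h h'; apply: val_inj; move: (Gi _ _ _ _ _ _ h h').
  by case: (val p) (val p') => ? ? [].
pose f p := projT1 (cid (Hf p)); pose g q := projT1 (cid (Hg q)).
have fP p : H p (f p) by rewrite /f; case: cid.
have gP q : H (g q) q by rewrite /g; case: cid.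
exists f; split.
  exists g => [p|q]; first exact: Hinj (gP _) (fP _).
  exact: Hfun (fP _) (gP _).
move=> i j; apply: (cc_ext (D := @definable R M)) (dG i j) => v /=; split.
  move=> Gv; have [Av Bv] := GAB _ _ _ _ Gv.
  have px : existT _ i (lsubmx v) \in points A by rewrite inE.
  have qy : existT _ j (rsubmx v) \in points B by rewrite inE.
  exists (SigSub px) => //; rewrite (_ : f _ = SigSub qy)//.
  by apply: (Hfun (SigSub px)); [exact: fP|exact: Gv].
by move=> [p pE qE]; have := fP p; rewrite /H /= pE qE.
Qed.

Lemma family_iso_sym I J (A : I -> defset) (B : J -> defset) :
  family_iso A B -> family_iso B A.
Proof.
move=> /family_isoP[G [dG GAB [GA GB] Gf Gi]]; apply/family_isoP.
exists (fun j i y x => G i j x y); split.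
- move=> j i; apply: (cc_ext (D := @definable R M)) (cc_sub2 Dc (@rsubE _ _ _ _) (@lsubE _ _ _ _) (dG i j)) => v /=.
  by rewrite row_mxKl row_mxKr.
- by move=> j i y x /GAB[].
- by split.
- by move=> j i i' y x x' h h'; exact: Gi h h'.
- by move=> j j' i y y' x h h'; exact: Gf h h'.
Qed.

Lemma family_iso_trans I (J : finType) K (A : I -> defset) (B : J -> defset)
    (C : K -> defset) : family_iso A B -> family_iso B C -> family_iso A C.
Proof.
move=> /family_isoP[G [dG GAB [GA GB] Gf Gi]].
move=> /family_isoP[H [dH HBC [HB HC] Hf Hi]]; apply/family_isoP.
exists (fun i k x z => exists j y, G i j x y /\ H j k y z); split.
- move=> i k; apply: (cc_ext (D := @definable R M))
    (definable_bigU (fun j => cc_comp Dc (dG i j) (dH j k))) => v /=.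
  by split=> -[j [y h]]; exists j, y; move: h; rewrite !row_mxKl !row_mxKr.
- by move=> i k x z [j [y [/GAB[? _] /HBC[]]]].
- split=> [i x /GA[j [y Gy]]|k z /HC[j [y Hy]]].
    by have [k [z Hz]] := HB _ _ (GAB _ _ _ _ Gy).2; exists k, z, j, y.
  by have [i [x Gx]] := GB _ _ (HBC _ _ _ _ Hy).1; exists i, x, j, y.
- move=> i k k' x z z' [j [y [Gy Hz]]] [j' [y' [Gy' Hz']]].
  have E := Gf _ _ _ _ _ _ Gy Gy'.
  pose Q (p : {j : J & 'rV[M]_(def_dim (B j))}) := H (tag p) k' (tagged p) z'.
  have {}Hz' : H j k' y z' by rewrite -[H _ _ _ _]/(Q (existT _ j y)) E.
  exact: Hf Hz Hz'.
- move=> i i' k x x' z [j [y [Gy Hz]]] [j' [y' [Gy' Hz']]].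
  have E := Hi _ _ _ _ _ _ Hz Hz'.
  pose Q (p : {j : J & 'rV[M]_(def_dim (B j))}) := G i' (tag p) x' (tagged p).
  have {}Gy' : G i' j x' y by rewrite -[G _ _ _ _]/(Q (existT _ j y)) E.
  exact: Gi Gy Gy'.
Qed.

Lemma family_iso_pieces (I J : eqType) (A : I -> defset) (B : J -> defset)
    (h : I -> J) : bijective h -> (forall i, defset_iso (A i) (B (h i))) ->
  family_iso A B.
Proof.
move=> [g hK gK] AB.
have {}AB i := (isoP _ _ _).1 (AB i).
pose G i := projT1 (cid (AB i)).
have GP i : [/\ definable [set v | G i (lsubmx v) (rsubmx v)],
      forall x y, G i x y -> def_carrier (A i) x /\ def_carrier (B (h i)) y,
      (forall x, def_carrier (A i) x -> exists y, G i x y) /\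
      (forall y, def_carrier (B (h i)) y -> exists x, G i x y),
      forall x y y', G i x y -> G i x y' -> y = y' &
      forall x x' y, G i x y -> G i x' y -> x = x'].
  by rewrite /G; case: cid.
apply/family_isoP; exists (fun i j x y => exists2 y', G i x y' &
   existT (fun j => 'rV[M]_(def_dim (B j))) (h i) y' = existT _ j y); split.
- move=> i j; have [hij|hij] := eqVneq (h i) j.
    subst j; have [dG _ _ _ _] := GP i.
    apply: (cc_ext (D := @definable R M)) dG => v /=; split.
      by exists (rsubmx v).
    by move=> [y' Gy E]; rewrite -(eq_from_Tagged (E : Tagged _ y' = Tagged _ (rsubmx v))).
  apply: (cc_ext (D := @definable R M)) (definable_set0 _) => v /=; split=> //.
  by move=> [y' _ E]; move: hij; rewrite (projT1_eq E : h i = j) eqxx.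
- move=> i j x y [y' Gy E].
  have [_ /(_ _ _ Gy)[Ax By] _ _ _] := GP i; split=> //; pose Q (p : {j : J & 'rV[M]_(def_dim (B j))}) := def_carrier (B (tag p)) (tagged p).
  by rewrite -[def_carrier (B j) y]/(Q (existT _ j y)) -E.
- split=> [i x Ax|j y].
    by have [_ _ [k _] _ _] := GP i; have [y Gy] := k x Ax; exists (h i), y, y.
  have [i ij] : exists i, h i = j by exists (g j).
  subst j => By; have [_ _ [_ k] _ _] := GP i; have [x Gx] := k y By.
  by exists i, x, y.
- move=> i j j' x y y' [z Gz <-] [z' Gz' <-]; have [_ _ _ k _] := GP i.
  by rewrite (k _ _ _ Gz Gz').
- move=> i i' j x x' y [z Gz Ez] [z' Gz' E]; rewrite -{}E in Ez.
  have ii : i = i' by apply: (can_inj hK); exact: (projT1_eq Ez).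
  subst i'; have zz := eq_from_Tagged (Ez : Tagged _ z = Tagged _ z').
  by subst z'; have [_ _ _ _ k] := GP i; rewrite (k _ _ _ Gz Gz').
Qed.

Lemma family_iso_refl (I : eqType) (A : I -> defset) : family_iso A A.
Proof.
apply: (@family_iso_pieces _ _ _ _ id); last by move=> i; exact: defset_iso_refl.
exact: inv_bij.
Qed.

Definition sum_fam I J (A : I -> defset) (B : J -> defset) (s : I + J) :=
  match s with inl i => A i | inr j => B j end.
Definition prod_fam I J (A : I -> defset) (B : J -> defset) (p : I * J) :=
  defprod (A p.1) (B p.2).

Lemma sum_fam_iso I J I' J' (A : I -> defset) (B : J -> defset)
    (A' : I' -> defset) (B' : J' -> defset) :
  family_iso A A' -> family_iso B B' -> family_iso (sum_fam A B) (sum_fam A' B').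
Proof.
move=> /family_isoP[G [dG GAB [GA GB] Gf Gi]].
move=> /family_isoP[H [dH HAB [HA HB] Hf Hi]]; apply/family_isoP.
exists (fun s t : _ + _ => match s, t return 'rV[M]_(def_dim (sum_fam A B s)) ->
    'rV[M]_(def_dim (sum_fam A' B' t)) -> Prop with
  | inl i, inl j => G i j | inr i, inr j => H i j | _, _ => fun _ _ => False end).
split.
- by move=> [i|i] [j|j]; [exact: dG|exact: definable_set0
    |exact: definable_set0|exact: dH].
- by move=> [i|i] [j|j] x y //; [exact: GAB|exact: HAB].
- split=> [[i x /GA|i x /HA]|[i x /GB|i x /HB]] [j [y h]].
  + by exists (inl j), y.
  + by exists (inr j), y.
  + by exists (inl j), y.
  + by exists (inr j), y.
- move=> [i|i] [j|j] [j'|j'] x y y' // h h'.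
    pose Q (p : {j : I' & 'rV[M]_(def_dim (A' j))}) :
      {j : I' + J' & 'rV[M]_(def_dim (sum_fam A' B' j))} := existT _ (inl (tag p)) (tagged p).
    by rewrite -[LHS]/(Q (existT _ j y)) (Gf _ _ _ _ _ _ h h').
  pose Q (p : {j : J' & 'rV[M]_(def_dim (B' j))}) :
      {j : I' + J' & 'rV[M]_(def_dim (sum_fam A' B' j))} := existT _ (inr (tag p)) (tagged p).
  by rewrite -[LHS]/(Q (existT _ j y)) (Hf _ _ _ _ _ _ h h').
- move=> [i|i] [i'|i'] [j|j] x x' y // h h'.
    pose Q (p : {j : I & 'rV[M]_(def_dim (A j))}) :
      {j : I + J & 'rV[M]_(def_dim (sum_fam A B j))} := existT _ (inl (tag p)) (tagged p).
    by rewrite -[LHS]/(Q (existT _ i x)) (Gi _ _ _ _ _ _ h h').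
  pose Q (p : {j : J & 'rV[M]_(def_dim (B j))}) :
      {j : I + J & 'rV[M]_(def_dim (sum_fam A B j))} := existT _ (inr (tag p)) (tagged p).
  by rewrite -[LHS]/(Q (existT _ i x)) (Hi _ _ _ _ _ _ h h').
Qed.

Lemma prod_fam_iso I J I' J' (A : I -> defset) (B : J -> defset)
    (A' : I' -> defset) (B' : J' -> defset) :
  family_iso A A' -> family_iso B B' -> family_iso (prod_fam A B) (prod_fam A' B').
Proof.
move=> /family_isoP[G [dG GAB [GA GB] Gf Gi]].
move=> /family_isoP[H [dH HAB [HA HB] Hf Hi]]; apply/family_isoP.
exists (fun s t x y => G s.1 t.1 (lsubmx x) (lsubmx y) /\
                       H s.2 t.2 (rsubmx x) (rsubmx y)).
split.
- move=> [i i'] [j j']; apply: (cc_ext (D := @definable R M)) (cc_prodrel Dc (dG i j) (dH i' j')) => v /=.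
  by rewrite !row_mxKl !row_mxKr.
- by move=> [i i'] [j j'] x y [/GAB[? ?] /HAB[? ?]].
- split=> -[i i'] x [].
    move=> /GA[j [y Gy]] /HA[j' [z Hz]]; exists (j, j'), (row_mx y z).
    by rewrite row_mxKl row_mxKr.
  move=> /GB[j [y Gy]] /HB[j' [z Hz]]; exists (j, j'), (row_mx y z).
  by rewrite row_mxKl row_mxKr.
- move=> [i i'] [j j'] [k k'] x y z [/= G1 H1] [/= G2 H2].
  pose Q (p : {j : I' & 'rV[M]_(def_dim (A' j))}) (q : {j : J' & 'rV[M]_(def_dim (B' j))}) :
    {j : I' * J' & 'rV[M]_(def_dim (prod_fam A' B' j))} :=
    existT _ (tag p, tag q) (row_mx (tagged p) (tagged q)).
  rewrite -[y]hsubmxK -[z]hsubmxK.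
  rewrite -[LHS]/(Q (existT _ j (lsubmx y)) (existT _ j' (rsubmx y))).
  by rewrite (Gf _ _ _ _ _ _ G1 G2) (Hf _ _ _ _ _ _ H1 H2).
- move=> [i i'] [k k'] [j j'] x z y [/= G1 H1] [/= G2 H2].
  pose Q (p : {j : I & 'rV[M]_(def_dim (A j))}) (q : {j : J & 'rV[M]_(def_dim (B j))}) :
    {j : I * J & 'rV[M]_(def_dim (prod_fam A B j))} :=
    existT _ (tag p, tag q) (row_mx (tagged p) (tagged q)).
  rewrite -[x]hsubmxK -[z]hsubmxK.
  rewrite -[LHS]/(Q (existT _ i (lsubmx x)) (existT _ i' (rsubmx x))).
  by rewrite (Gi _ _ _ _ _ _ G1 G2) (Hi _ _ _ _ _ _ H1 H2).
Qed.

End DefinableSets.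

Section Semiring.
Variables (R : pzRingType) (M : lmodType R^c).

(* The classes of definable sets under definable isomorphism, with
   [A] + [B] := [A' u B'] for disjoint representatives A' and B'. If M = 0 every
   definable set has at most one point, so that 1 + 1 has no such representatives
   and the classes of definable sets alone do not form a semiring. The sum is
   therefore always realized as a tagged union: elements of DefClass are classes
   of finite families of definable sets. Below, class_ofP, class_ofU,
   class_of_prod, class_of0, class_of1 and class_of_surj show that if M is nonzero
   this is exactly the semiring of classes of definable sets (families of length 1
   already give everything); if M = 0 it is the semiring of natural numbers. *)
Record family := Family {
  fam_size : nat;
  fam_piece :> 'I_fam_size -> defset M }.

HB.instance Definition _ := gen_eqMixin family.
HB.instance Definition _ := gen_choiceMixin family.

Definition fam_rel (X Y : family) : bool := `[< family_iso X Y >].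

Lemma fam_rel_refl : reflexive fam_rel.
Proof. by move=> X; apply/asboolP/family_iso_refl. Qed.

Lemma fam_rel_sym : symmetric fam_rel.
Proof. by move=> X Y; apply/asboolP/asboolP; exact: family_iso_sym. Qed.

Lemma fam_rel_trans : transitive fam_rel.
Proof.
by move=> Y X Z /asboolP XY /asboolP YZ; apply/asboolP/(family_iso_trans XY YZ).
Qed.

Canonical fam_equiv := EquivRel fam_rel fam_rel_refl fam_rel_sym fam_rel_trans.

Definition DefClass := {eq_quot fam_rel}.
HB.instance Definition _ := Choice.on DefClass.

Definition fam_of (I : finType) (A : I -> defset M) : family :=
  Family (A \o @enum_val I I).

Definition class_of_fam (I : finType) (A : I -> defset M) : DefClass := \pi_DefClass (fam_of A).

Lemma fam_of_iso (I : finType) (A : I -> defset M) : family_iso (fam_of A) A.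
Proof.
apply: (@family_iso_pieces _ _ _ _ _ _ (@enum_val I I)); first exact: enum_val_bij.
by move=> i; exact: defset_iso_refl.
Qed.

Lemma clsP (I J : finType) (A : I -> defset M) (B : J -> defset M) :
  class_of_fam A = class_of_fam B <-> family_iso A B.
Proof.
have [hA hB] := (fam_of_iso A, fam_of_iso B).
split=> [/eqmodP/asboolP h|h]; last apply/eqmodP/asboolP.
  exact: family_iso_trans (family_iso_trans (family_iso_sym hA) h) hB.
exact: family_iso_trans (family_iso_trans hA h) (family_iso_sym hB).
Qed.

Lemma cls_pi (X : family) : class_of_fam X = \pi_DefClass X.
Proof. exact/eqmodP/asboolP/fam_of_iso. Qed.

Lemma clsW (T : DefClass -> Prop) :
  (forall (I : finType) (A : I -> defset M), T (class_of_fam A)) -> forall x, T x.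
Proof. by move=> h; apply: quotW => X; rewrite -cls_pi. Qed.

Definition DefClass_zero : DefClass := class_of_fam (fun i : 'I_0 => defset0 M).
Definition DefClass_one : DefClass := class_of_fam (fun i : 'I_1 => defsingle M).
Definition DefClass_add (x y : DefClass) : DefClass := class_of_fam (sum_fam (repr x) (repr y)).
Definition DefClass_mul (x y : DefClass) : DefClass := class_of_fam (prod_fam (repr x) (repr y)).

Lemma repr_cls (I : finType) (A : I -> defset M) : family_iso (repr (class_of_fam A)) A.
Proof.
have /eqmodP/asboolP h := reprK (class_of_fam A); exact: family_iso_trans h (fam_of_iso A).
Qed.

Lemma DefClass_addE (I J : finType) (A : I -> defset M) (B : J -> defset M) :
  DefClass_add (class_of_fam A) (class_of_fam B) = class_of_fam (sum_fam A B).
Proof. by apply/clsP/sum_fam_iso; exact: repr_cls. Qed.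

Lemma DefClass_mulE (I J : finType) (A : I -> defset M) (B : J -> defset M) :
  DefClass_mul (class_of_fam A) (class_of_fam B) = class_of_fam (prod_fam A B).
Proof. by apply/clsP/prod_fam_iso; exact: repr_cls. Qed.

Lemma cls_pieces (I J : finType) (A : I -> defset M) (B : J -> defset M)
    (h : I -> J) (g : J -> I) : cancel h g -> cancel g h ->
  (forall i, defset_iso (A i) (B (h i))) -> class_of_fam A = class_of_fam B.
Proof.
by move=> hK gK AB; apply/clsP; apply: family_iso_pieces AB; exists g.
Qed.

Lemma DefClass_addA : associative DefClass_add.
Proof.
elim/clsW=> I A; elim/clsW=> J B; elim/clsW=> K C.
rewrite (DefClass_addE B C) (DefClass_addE A B) DefClass_addE DefClass_addE.
apply: (@cls_pieces _ _ _ _ (fun s => match s with inl i => inl (inl i)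
     | inr (inl j) => inl (inr j) | inr (inr k) => inr k end)
   (fun s => match s with inl (inl i) => inl i
     | inl (inr j) => inr (inl j) | inr k => inr (inr k) end)).
- by move=> [i|[j|k]].
- by move=> [[i|j]|k].
- by move=> [i|[j|k]]; exact: defset_iso_refl.
Qed.

Lemma DefClass_addC : commutative DefClass_add.
Proof.
elim/clsW=> I A; elim/clsW=> J B; rewrite DefClass_addE DefClass_addE.
apply: (@cls_pieces _ _ _ _ (fun s => match s with inl i => inr i | inr j => inl j end)
   (fun s => match s with inl i => inr i | inr j => inl j end)).
- by move=> [i|j].
- by move=> [i|j].
- by move=> [i|j]; exact: defset_iso_refl.
Qed.

Lemma DefClass_add0 : left_id DefClass_zero DefClass_add.
Proof.
elim/clsW=> I A; rewrite DefClass_addE; symmetry.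
apply: (@cls_pieces _ _ _ _ (fun i => inr i)
  (fun s : 'I_0 + I => match s with inl i => False_rect _ (notF (ltn_ord i)) | inr j => j end)).
- by [].
- by move=> [[]|].
- by move=> i; exact: defset_iso_refl.
Qed.

HB.instance Definition _ := GRing.isNmodule.Build DefClass
  DefClass_addA DefClass_addC DefClass_add0.

Lemma DefClass_mulA : associative DefClass_mul.
Proof.
elim/clsW=> I A; elim/clsW=> J B; elim/clsW=> K C.
rewrite (DefClass_mulE B C) (DefClass_mulE A B) DefClass_mulE DefClass_mulE.
apply: (@cls_pieces _ _ _ _ (fun s => ((s.1, s.2.1), s.2.2))
   (fun s => (s.1.1, (s.1.2, s.2)))).
- by move=> [i [j k]].
- by move=> [[i j] k].
- by move=> [i [j k]]; apply: (iso_productA (definable_closed M)); exact: def_carrierP.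
Qed.

Lemma DefClass_mulC : commutative DefClass_mul.
Proof.
elim/clsW=> I A; elim/clsW=> J B; rewrite DefClass_mulE DefClass_mulE.
apply: (@cls_pieces _ _ _ _ (fun s => (s.2, s.1)) (fun s => (s.2, s.1))).
- by move=> [i j].
- by move=> [i j].
- by move=> [i j]; apply: (iso_productC (definable_closed M)); exact: def_carrierP.
Qed.

Lemma DefClass_mul1 : left_id DefClass_one DefClass_mul.
Proof.
elim/clsW=> I A; rewrite DefClass_mulE.
apply: (@cls_pieces _ _ _ _ (fun s => s.2) (fun i => (ord0, i))).
- by move=> [i j] /=; rewrite (ord1 i).
- by [].
- by move=> [i j]; apply: (iso_product1 (definable_closed M)); exact: def_carrierP.
Qed.

Lemma DefClass_mulDl : left_distributive DefClass_mul DefClass_add.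
Proof.
elim/clsW=> I A; elim/clsW=> J B; elim/clsW=> K C.
rewrite (DefClass_addE A B) (DefClass_mulE _ C) (DefClass_mulE A C) (DefClass_mulE B C) DefClass_addE.
apply: (@cls_pieces _ _ _ _
   (fun s => match s.1 with inl i => inl (i, s.2) | inr j => inr (j, s.2) end)
   (fun s => match s with inl p => (inl p.1, p.2) | inr p => (inr p.1, p.2) end)).
- by move=> [[i|j] k].
- by move=> [[i k]|[j k]].
- by move=> [[i|j] k]; exact: defset_iso_refl.
Qed.

Lemma DefClass_mul0 : left_zero DefClass_zero DefClass_mul.
Proof.
elim/clsW=> I A; rewrite DefClass_mulE.
apply: (@cls_pieces _ _ _ _ (fun s => s.1)
  (fun i : 'I_0 => False_rect _ (notF (ltn_ord i)))).
- by move=> [[]].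
- by case.
- by move=> [[]].
Qed.

HB.instance Definition _ := GRing.Nmodule_isComPzSemiRing.Build DefClass
  DefClass_mulA DefClass_mulC DefClass_mul1 DefClass_mulDl DefClass_mul0.

Definition class_of (A : defset M) : DefClass := class_of_fam (fun _ : 'I_1 => A).

Lemma class_ofP (A B : defset M) :
  class_of A = class_of B <-> isomorphic_in (@definable R M) A B.
Proof.
split=> [/clsP/family_isoP[G [dG GAB [GA GB] Gf Gi]]|AB]; last first.
  by apply: (@cls_pieces _ _ _ _ id id).
apply/isoP; exists (G ord0 ord0); split.
- exact: dG.
- by move=> x y /GAB.
- split=> [x /(GA ord0)[j [y]]|y /(GB ord0)[j [y']]]; rewrite (ord1 j).
    by exists y.
  by exists y'.
- by move=> x y y' h h'; have E := Gf _ _ _ _ _ _ h h';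
    exact: (eq_from_Tagged (E : Tagged (fun=> 'rV[M]_(def_dim B)) y = Tagged _ y')).
- by move=> x x' y h h'; have E := Gi _ _ _ _ _ _ h h';
    exact: (eq_from_Tagged (E : Tagged (fun=> 'rV[M]_(def_dim A)) x = Tagged _ x')).
Qed.

Lemma class_of_prod A B : class_of (defprod A B) = class_of A * class_of B.
Proof.
rewrite [RHS]DefClass_mulE; apply: (@cls_pieces _ _ _ _ (fun=> (ord0, ord0)) (fun=> ord0)).
- by move=> i; rewrite (ord1 i).
- by move=> [i j]; rewrite (ord1 i) (ord1 j).
- by move=> i; exact: defset_iso_refl.
Qed.

Lemma class_of1 n (n_gt0 : (0 < n)%N) (a : 'rV[M]_n) :
  class_of (defpoint n_gt0 a) = 1.
Proof. exact/class_ofP/(iso_point (definable_closed M)). Qed.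

Lemma class_of0 (A : defset M) : def_carrier A = set0 -> class_of A = 0.
Proof.
move=> A0; apply/clsP/family_isoP; exists (fun _ _ _ _ => False); split=> //.
- by move=> i [].
- by split=> [i x|[]//]; rewrite A0.
Qed.

Lemma class_ofU n (n_gt0 : (0 < n)%N) (X Y : set 'rV[M]_n)
    (dX : definable X) (dY : definable Y) : X `&` Y = set0 ->
  class_of (DefSet n_gt0 (definableU dX dY)) =
  class_of (DefSet n_gt0 dX) + class_of (DefSet n_gt0 dY).
Proof.
move=> XY0; rewrite [RHS]DefClass_addE; apply/clsP/family_isoP.
have Dc := definable_closed M.
have disj x : X x -> Y x -> False.
  by move=> Xx Yx; have : (X `&` Y) x by []; rewrite XY0.
exists (fun _ (s : 'I_1 + 'I_1) => match s return 'rV[M]_n ->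
    'rV[M]_(def_dim (sum_fam (fun=> DefSet n_gt0 dX) (fun=> DefSet n_gt0 dY) s)) -> Prop with
  | inl _ => fun x y => X x /\ x = y | inr _ => fun x y => Y x /\ x = y end).
split.
- move=> i [j|j]; apply: (cc_and Dc); try exact: (cc_lsub Dc).
    exact: (cc_eqv Dc (@lsubE _ _ _ _) (@rsubE _ _ _ _)).
  exact: (cc_eqv Dc (@lsubE _ _ _ _) (@rsubE _ _ _ _)).
- by move=> i [j|j] x y /= [h <-]; split=> //; [left|right].
- split=> [i x /= [Xx|Yx]|[j|j] x /= h].
  + by exists (inl ord0), x.
  + by exists (inr ord0), x.
  + by exists ord0, x.
  + by exists ord0, x.
- move=> i [j|j] [j'|j'] x y y' /= [h <-] [h' <-]; rewrite ?(ord1 j) ?(ord1 j') //.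
    by case: (disj x).
  by case: (disj x).
- by move=> i i' [j|j] x x' y /= [h ->] [h' ->]; rewrite (ord1 i) (ord1 i').
Qed.

Lemma cls_sum n (A : 'I_n -> defset M) : class_of_fam A = \sum_i class_of (A i).
Proof.
elim: n A => [|n IH] A.
  by rewrite big_ord0; apply: (@cls_pieces _ _ _ _ id id) => // -[].
rewrite big_ord_recl -IH [RHS]DefClass_addE.
apply: (@cls_pieces _ _ _ _
  (fun i => if unlift ord0 i is Some j then inr j else inl ord0)
  (fun s => match s with inl _ => ord0 | inr j => lift ord0 j end)).
- by move=> i; case: unliftP => [j|] ->.
- by move=> [j|j]; rewrite ?unlift_none ?(ord1 j) ?liftK.
- by move=> i; case: unliftP => [j|] ->; exact: defset_iso_refl.
Qed.

Lemma class_of_surj : (exists x : M, x <> 0) -> forall x : DefClass, exists A, x = class_of A.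
Proof.
move=> [c c0]; elim/quotW=> X; rewrite -cls_pi cls_sum.
have Dc := definable_closed M.
apply: (big_ind (fun x => exists A, x = class_of A)) => [|x y [A ->] [B ->]|i _]; last by exists (fam_piece i).
  by exists (defset0 M); rewrite class_of0.
have n_gt0 : (0 < (def_dim A + def_dim B) + 1)%N by rewrite addn1.
pose oA : set 'rV[M]_(def_dim A) := [set 0].
pose oB : set 'rV[M]_(def_dim B) := [set 0].
pose o1 : set 'rV[M]_1 := [set 0].
pose c1 : set 'rV[M]_1 := [set const_mx c].
pose X1 := product_set (product_set A oB) o1.
pose Y1 := product_set (product_set oA B) c1.
have [dA dB] := (def_carrierP A, def_carrierP B).
have dX1 : definable X1.
  by apply: (cc_product Dc); [apply: (cc_product Dc) => //|]; exact: (cc_point Dc).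
have dY1 : definable Y1.
  by apply: (cc_product Dc); [apply: (cc_product Dc) => //|]; exact: (cc_point Dc).
exists (DefSet n_gt0 (definableU dX1 dY1)).
rewrite class_ofU; last first.
  apply/seteqP; split=> // v [[_ /= v0] [_ /= v1]]; apply: c0.
  by move: v1; rewrite v0 => /rowP/(_ 0); rewrite !mxE.
congr (_ + _); apply/class_ofP/(iso_sym Dc).
  apply: (iso_trans Dc) (iso_product1r Dc 0 dA).
  by apply: (iso_product1r Dc); apply: (cc_product Dc) => //; exact: (cc_point Dc).
apply: (iso_trans Dc) (iso_product1 Dc 0 dB).
by apply: (iso_product1r Dc); apply: (cc_product Dc) => //; exact: (cc_point Dc).
Qed.

End Semiring.

(* The Grothendieck ring of a commutative semiring: formal differences a - b, with
   a - b = c - d iff a + d + k = c + b + k for some k. *)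
Section Grothendieck.
Variable S : comPzSemiRingType.

Definition groth_rel (p q : S * S) : bool :=
  `[< exists k, p.1 + q.2 + k = q.1 + p.2 + k >].

Lemma groth_refl : reflexive groth_rel.
Proof. by move=> p; apply/asboolP; exists 0. Qed.

Lemma groth_sym : symmetric groth_rel.
Proof. by move=> p q; apply/asboolP/asboolP=> -[k kP]; exists k. Qed.

Lemma groth_trans : transitive groth_rel.
Proof.
move=> q p r /asboolP[k kP] /asboolP[l lP]; apply/asboolP.
exists (q.1 + q.2 + k + l).
transitivity ((p.1 + q.2 + k) + (q.1 + r.2 + l)); first by ring.
by rewrite kP lP; ring.
Qed.

Canonical groth_equiv := EquivRel groth_rel groth_refl groth_sym groth_trans.

Definition groth := {eq_quot groth_rel}.
HB.instance Definition _ := Choice.on groth.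

Definition groth_diff (a b : S) : groth := \pi_groth (a, b).

Lemma groth_diffP a b c d :
  groth_diff a b = groth_diff c d <-> exists k, a + d + k = c + b + k.
Proof. by split=> [/eqmodP/asboolP//|h]; apply/eqmodP/asboolP. Qed.

Lemma grothW (T : groth -> Prop) :
  (forall a b, T (groth_diff a b)) -> forall x, T x.
Proof. by move=> h; apply: quotW => -[a b]; exact: h. Qed.

Lemma groth_repr (x : groth) : groth_diff (repr x).1 (repr x).2 = x.
Proof. by rewrite /groth_diff -surjective_pairing reprK. Qed.

Definition groth_add (x y : groth) : groth :=
  groth_diff ((repr x).1 + (repr y).1) ((repr x).2 + (repr y).2).
Definition groth_opp (x : groth) : groth := groth_diff (repr x).2 (repr x).1.
Definition groth_mul (x y : groth) : groth :=
  groth_diff ((repr x).1 * (repr y).1 + (repr x).2 * (repr y).2)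
             ((repr x).1 * (repr y).2 + (repr x).2 * (repr y).1).

Lemma groth_addE a b c d :
  groth_add (groth_diff a b) (groth_diff c d) = groth_diff (a + c) (b + d).
Proof.
have /groth_diffP[k kP] := groth_repr (groth_diff a b).
have /groth_diffP[l lP] := groth_repr (groth_diff c d).
apply/groth_diffP; exists (k + l); move: (repr (groth_diff a b)) (repr (groth_diff c d)) kP lP => p q kP lP.
transitivity ((p.1 + b + k) + (q.1 + d + l)); first by ring.
by rewrite kP lP; ring.
Qed.

Lemma groth_oppE a b : groth_opp (groth_diff a b) = groth_diff b a.
Proof.
have /groth_diffP[k kP] := groth_repr (groth_diff a b).
by apply/groth_diffP; exists k; rewrite (addrC _ a) (addrC b) kP.
Qed.

Definition groth_pmul (p q : S * S) : S * S :=
  (p.1 * q.1 + p.2 * q.2, p.1 * q.2 + p.2 * q.1).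

Lemma groth_pmulC p q : groth_pmul p q = groth_pmul q p.
Proof. by rewrite /groth_pmul; congr pair; ring. Qed.

Lemma groth_rel_pmul p q r :
  groth_rel p q -> groth_rel (groth_pmul p r) (groth_pmul q r).
Proof.
move=> /asboolP[k kP]; apply/asboolP; exists (k * (r.1 + r.2)) => /=.
transitivity ((p.1 + q.2 + k) * r.1 + (q.1 + p.2 + k) * r.2); first by ring.
by rewrite kP -{2}kP; ring.
Qed.

Lemma groth_mulE a b c d : groth_mul (groth_diff a b) (groth_diff c d) =
  groth_diff (a * c + b * d) (a * d + b * c).
Proof.
have /eqmodP h1 := groth_repr (groth_diff a b).
have /eqmodP h2 := groth_repr (groth_diff c d).
apply/eqmodP; rewrite -!surjective_pairing in h1 h2.
apply: groth_trans (groth_rel_pmul (repr (groth_diff c d)) h1) _.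
by rewrite groth_pmulC [X in groth_rel _ X](groth_pmulC (a, b) (c, d));
   exact: groth_rel_pmul.
Qed.

Lemma groth_addA : associative groth_add.
Proof.
by elim/grothW=> a b; elim/grothW=> c d; elim/grothW=> e f;
   rewrite !groth_addE !addrA.
Qed.

Lemma groth_addC : commutative groth_add.
Proof.
by elim/grothW=> a b; elim/grothW=> c d; rewrite !groth_addE addrC (addrC b).
Qed.

Lemma groth_add0 : left_id (groth_diff 0 0) groth_add.
Proof. by elim/grothW=> a b; rewrite groth_addE !add0r. Qed.

Lemma groth_addN : left_inverse (groth_diff 0 0) groth_opp groth_add.
Proof.
elim/grothW=> a b; rewrite groth_oppE groth_addE.
by apply/groth_diffP; exists 0; rewrite addrC [b + a]addrC; ring.
Qed.

HB.instance Definition _ := GRing.isZmodule.Build groth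
  groth_addA groth_addC groth_add0 groth_addN.

Lemma groth_mulA : associative groth_mul.
Proof.
elim/grothW=> a b; elim/grothW=> c d; elim/grothW=> e f.
by rewrite !groth_mulE; congr groth_diff; ring.
Qed.

Lemma groth_mulC : commutative groth_mul.
Proof.
elim/grothW=> a b; elim/grothW=> c d.
by rewrite !groth_mulE; congr groth_diff; ring.
Qed.

Lemma groth_mul1 : left_id (groth_diff 1 0) groth_mul.
Proof. by elim/grothW=> a b; rewrite groth_mulE; congr groth_diff; ring. Qed.

Lemma groth_mulDl : left_distributive groth_mul groth_add.
Proof.
elim/grothW=> a b; elim/grothW=> c d; elim/grothW=> e f.
by rewrite (groth_addE a b c d) !groth_mulE groth_addE; congr groth_diff; ring.
Qed.

HB.instance Definition _ := GRing.Zmodule_isComPzRing.Build groth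
  groth_mulA groth_mulC groth_mul1 groth_mulDl.

Definition to_groth (s : S) : groth := groth_diff s 0.

Lemma to_groth_nmod : nmod_morphism to_groth.
Proof.
by split=> // s t; rewrite /to_groth [RHS]groth_addE addr0.
Qed.

Lemma to_groth_monoid : monoid_morphism to_groth.
Proof.
split=> // s t; rewrite /to_groth [RHS]groth_mulE.
by congr groth_diff; ring.
Qed.

HB.instance Definition _ := GRing.isNmodMorphism.Build S groth to_groth to_groth_nmod.
HB.instance Definition _ := GRing.isMonoidMorphism.Build S groth to_groth to_groth_monoid.

Lemma groth_diffE a b : groth_diff a b = to_groth a - to_groth b.
Proof.
rewrite -[RHS]/(groth_add (groth_diff a 0) (groth_opp (groth_diff b 0))).
by rewrite groth_oppE groth_addE add0r addr0.
Qed.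

Lemma groth_universal (K : comPzRingType) (f : {rmorphism S -> K}) :
  exists g : {rmorphism groth -> K}, (forall s, g (to_groth s) = f s) /\
    forall g' : {rmorphism groth -> K},
      (forall s, g' (to_groth s) = f s) -> g' =1 g.
Proof.
pose g (x : groth) := f (repr x).1 - f (repr x).2.
have gE a b : g (groth_diff a b) = f a - f b.
  have /groth_diffP[k /(congr1 f)] := groth_repr (groth_diff a b).
  rewrite !rmorphD => /addIr E; rewrite /g.
  by apply/eqP; rewrite subr_eq addrAC eq_sym subr_eq E addrC.
have gB : zmod_morphism g.
  elim/grothW=> a b; elim/grothW=> c d.
  rewrite (_ : _ - _ = groth_diff (a + d) (b + c)); last first.
    rewrite -[LHS]/(groth_add (groth_diff a b) (groth_opp (groth_diff c d))).
    by rewrite groth_oppE groth_addE.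
  by rewrite !gE !rmorphD; ring.
have gM : monoid_morphism g.
  split; first by rewrite (gE 1 0) rmorph1 rmorph0 subr0.
  elim/grothW=> a b; elim/grothW=> c d; rewrite [_ * _]groth_mulE !gE.
  by rewrite !rmorphD !rmorphM; ring.
pose gA := GRing.isZmodMorphism.Build _ _ g gB.
pose gMM := GRing.isMonoidMorphism.Build _ _ g gM.
pose h : {rmorphism groth -> K} := HB.pack g gA gMM.
exists h; split=> [s|h' h'E]; first by rewrite /h /= gE rmorph0 subr0.
elim/grothW=> a b; rewrite [RHS]gE groth_diffE rmorphB.
by rewrite !h'E.
Qed.

End Grothendieck.

Definition K0 (R : pzRingType) (M : lmodType R^c) := groth (DefClass M).
HB.instance Definition _ (R : pzRingType) (M : lmodType R^c) :=
  GRing.ComPzRing.on (K0 M).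

(* Main.v *)
From HB Require Import structures.
Require Import Defs.
From mathcomp Require Import all_boot all_order all_algebra.
From mathcomp Require Import boolp classical_sets functions cardinality.
From mathcomp Require Import generic_quotient monalg.

(* For M = M^(aleph_0), a finite family of cosets of pp-subgroups B_i not
   containing A cannot cover A: over the direct sum, choose d_i in A but not in
   B_i and place the d_i in distinct coordinates outside the supports of the coset
   representatives; the conclusion is a first-order sentence, so it transfers to M.
   Hence a nonempty pp-set covered by finitely many pp-sets is contained in one of
   them, and the indicators of distinct nonempty pp-sets are linearly independent.

   The indicator of a definable set is an integral combination of indicators of
   pp-sets, uniquely by independence, so P |-> [[P]] extends additively to all
   definable sets. The extension is invariant under definable bijections: if a
   coordinate projection is injective on X, the covering property forces it to be
   injective on every pp-set P in the reduced expression of the indicator of X, and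
   then P and its image have the same colour. This gives K_0(M) -> Z[colours]; it is
   onto by construction, and injective because [X] is the same integral combination
   of the classes [P] in K_0(M). *)

Set Implicit Arguments.
Unset Strict Implicit.
Unset Printing Implicit Defensive.

Import GRing.Theory.
Local Open Scope classical_set_scope.
Local Open Scope quotient_scope.
Local Open Scope ring_scope.

(** * First-order formulas and pp-subgroups *)

Section Formulas.
Variable R : pzRingType.

Definition FAnds n m (F : 'I_m -> formula R n) : formula R n :=
  foldr (@FAnd R n) (FEq TZero TZero) [seq F i | i <- enum 'I_m].

Lemma sat_FAnds (N : lmodType R^c) n m (F : 'I_m -> formula R n) (e : 'rV[N]_n) :
  sat (FAnds F) e <-> forall i, sat (F i) e.
Proof.
rewrite /FAnds.
suff H (s : seq 'I_m) : sat (foldr (@FAnd R n) (FEq TZero TZero) [seq F i | i <- s]) e <->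
    forall i, i \in s -> sat (F i) e.
  by rewrite H; split=> h i; [apply: h; rewrite mem_enum|move=> _].
elim: s => [|i s IH] //=; rewrite IH; split.
  by move=> [Fi Fs] j; rewrite inE => /predU1P[->//|/Fs].
by move=> h; split=> [|j js]; apply: h; rewrite inE ?eqxx ?js ?orbT.
Qed.

Fixpoint FExs n k : formula R (k + n) -> formula R n :=
  match k with
  | 0 => fun phi => phi
  | k'.+1 => fun phi => FExs (FEx (phi : formula R (k' + n).+1))
  end.

Lemma sat_FExs (N : lmodType R^c) n k (phi : formula R (k + n)) (e : 'rV[N]_n) :
  sat (FExs phi) e <-> exists y : 'rV[N]_k, sat phi (row_mx y e).
Proof.
elim: k phi => [|k IH] phi /=.
  split=> [h|[y]]; last by rewrite thinmx0 row_thin_mx.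
  by exists 0; rewrite row_thin_mx.
rewrite IH /=; split=> [[y [a]]|[y]].
  by rewrite row_mx1A => h; exists (row_mx (const_mx a : 'rV_1) y).
move=> h; exists (@rsubmx _ 1 1 k y), (y 0 0); rewrite row_mx1A.
suff -> : row_mx (const_mx (y 0 0)) (@rsubmx _ 1 1 k y) = y :> 'rV_(1 + k) by [].
rewrite -[RHS](@hsubmxK _ 1 1 k); congr row_mx.
by apply/rowP => i; rewrite !mxE ord1; congr (y 0 _); exact/val_inj.
Qed.

Definition TSum n m (F : 'I_m -> term R n) : term R n :=
  foldr (@TAdd R n) TZero [seq F i | i <- enum 'I_m].

Lemma eval_TSum (N : lmodType R^c) n m (F : 'I_m -> term R n) (e : 'rV[N]_n) :
  eval e (TSum F) = \sum_i eval e (F i).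
Proof.
rewrite /TSum -big_enum; elim: (enum 'I_m) => [|i s IH] /=; first by rewrite big_nil.
by rewrite big_cons IH.
Qed.

(** The product [x r] of a row over the right module [N] with a matrix over [R]. *)
Definition rmul (N : lmodType R^c) n t (x : 'rV[N]_n) (r : 'M[R]_(n, t)) : 'rV[N]_t :=
  \row_i \sum_j rscale (x 0 j) (r j i).

Lemma rmulD (N : lmodType R^c) n t (x y : 'rV[N]_n) (r : 'M[R]_(n, t)) :
  rmul (x + y) r = rmul x r + rmul y r.
Proof.
apply/rowP => i; rewrite !mxE -big_split /=; apply: eq_bigr => j _.
by rewrite mxE /rscale scalerDr.
Qed.

Lemma rmulN (N : lmodType R^c) n t (x : 'rV[N]_n) (r : 'M[R]_(n, t)) :
  rmul (- x) r = - rmul x r.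
Proof.
apply/rowP => i; rewrite !mxE -sumrN; apply: eq_bigr => j _.
by rewrite mxE /rscale scalerN.
Qed.

Lemma rmul0 (N : lmodType R^c) n t (r : 'M[R]_(n, t)) : rmul (0 : 'rV[N]_n) r = 0.
Proof.
by apply/rowP => i; rewrite !mxE big1 // => j _; rewrite mxE /rscale scaler0.
Qed.

Lemma map_rmul (N N' : lmodType R^c) (f : {linear N -> N'}) n t (x : 'rV[N]_n)
    (r : 'M[R]_(n, t)) : map_mx f (rmul x r) = rmul (map_mx f x) r.
Proof.
apply/rowP => i; rewrite !mxE raddf_sum; apply: eq_bigr => j _.
by rewrite mxE; exact: linearZZ.
Qed.

(** Treats the parameters [c] as further variables, so that an inhomogeneous system becomes a
    homogeneous one. *)
Lemma rmul_col_mx1 (N : lmodType R^c) n t (x : 'rV[N]_n) (c : 'rV[N]_t)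
    (r : 'M[R]_(n, t)) : rmul (row_mx x c) (col_mx r 1%:M) = rmul x r + c.
Proof.
apply/rowP => i; rewrite !mxE big_split_ord /=; congr (_ + _).
  by apply: eq_bigr => j _; rewrite row_mxEl col_mxEu.
rewrite (bigD1 i) //= big1 ?addr0 => [|j ji]; rewrite row_mxEr col_mxEd mxE.
  by rewrite eqxx /rscale scale1r.
by rewrite (negbTE ji) /rscale scale0r.
Qed.

(* The homogeneous system x r + y s = 0 in the variables x, with witnesses y. *)
Record pp_system n := PpSystem {
  ps_wit : nat;
  ps_eqs : nat;
  ps_coef : 'M[R]_(n, ps_eqs);
  ps_wcoef : 'M[R]_(ps_wit, ps_eqs) }.

Definition pp_subgroup n (h : pp_system n) (N : lmodType R^c) : set 'rV[N]_n :=
  [set x | exists y, rmul x (ps_coef h) + rmul y (ps_wcoef h) = 0].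

Section Subgroup.
Variables (n : nat) (h : pp_system n) (N : lmodType R^c).

Lemma pp_subgroup0 : pp_subgroup h (0 : 'rV[N]_n).
Proof. by exists 0; rewrite !rmul0 addr0. Qed.

Lemma pp_subgroupD (x y : 'rV[N]_n) :
  pp_subgroup h x -> pp_subgroup h y -> pp_subgroup h (x + y).
Proof.
by move=> [u hu] [v hv]; exists (u + v); rewrite !rmulD addrACA hu hv addr0.
Qed.

Lemma pp_subgroup_map (N' : lmodType R^c) (f : {linear N -> N'}) (x : 'rV[N]_n) :
  pp_subgroup h x -> pp_subgroup h (map_mx f x).
Proof.
move=> [u hu]; exists (map_mx f u).
by rewrite -!map_rmul -map_mxD hu map_mx0.
Qed.

End Subgroup.

(** Terms [T] are substituted for the variables of the system, so that membership of a difference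
    [b - a] can be expressed as well as that of [b]. *)
Definition pp_formula n (h : pp_system n) p (T : 'I_n -> term R p) : formula R p :=
  FExs (FAnds (fun i : 'I_(ps_eqs h) => FEq (TAdd
    (TSum (fun j => TScale (ren_term (@rshift (ps_wit h) p) (T j)) (ps_coef h j i)))
    (TSum (fun k => TScale (TVar R (lshift p k)) (ps_wcoef h k i)))) TZero)).

Lemma sat_pp_formula n (h : pp_system n) p (T : 'I_n -> term R p)
    (N : lmodType R^c) (e : 'rV[N]_p) :
  sat (pp_formula h T) e <-> pp_subgroup h (\row_j eval e (T j)).
Proof.
rewrite sat_FExs; have E (y : 'rV[N]_(ps_wit h)) :
    sat (FAnds (fun i : 'I_(ps_eqs h) => FEq (TAdd
    (TSum (fun j => TScale (ren_term (@rshift (ps_wit h) p) (T j)) (ps_coef h j i)))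
    (TSum (fun k => TScale (TVar R (lshift p k)) (ps_wcoef h k i)))) TZero)) (row_mx y e)
    <-> rmul (\row_j eval e (T j)) (ps_coef h) + rmul y (ps_wcoef h) = 0.
  rewrite sat_FAnds.
  have E i : \sum_j eval (row_mx y e)
      (TScale (ren_term (@rshift (ps_wit h) p) (T j)) (ps_coef h j i)) +
    \sum_i0 eval (row_mx y e) (TScale (TVar R (lshift p i0)) (ps_wcoef h i0 i)) =
    (rmul (\row_j eval e (T j)) (ps_coef h) + rmul y (ps_wcoef h)) 0 i.
    rewrite !mxE; congr (_ + _); apply: eq_bigr => j _ /=; last by rewrite row_mxEl.
    rewrite mxE eval_ren; congr (rscale (eval _ _) _).
    by apply/rowP => k; rewrite mxE row_mxEr.
  split=> [H|H i /=]; last by rewrite !eval_TSum E H mxE.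
  by apply/rowP => i; have /= := H i; rewrite !eval_TSum E => ->; rewrite mxE.
by split=> -[y hy]; exists y; apply/E; exact: hy.
Qed.

(** The sentence: for all [a_1, ..., a_m] some [b] in [A] lies outside every coset [a_i + B_i]. The
    universal quantifier is written as not-exists-not, and the [m] tuples form one block of [m * n]
    variables indexed by [mxvec_index]. *)
Definition avoid_formula n m (A : pp_system n) (B : 'I_m -> pp_system n) : formula R 0 :=
  let b j : term R (n + (m * n + 0)) := TVar R (lshift _ j) in
  let a i j : term R (n + (m * n + 0)) := TVar R (rshift n (lshift 0 (mxvec_index i j))) in
  FNot (FExs (FNot (FExs (FAnd (pp_formula A b)
    (FAnds (fun i => FNot (pp_formula (B i) (fun j => TAdd (b j) (TOpp (a i j)))))))))).

Lemma sat_avoid_formula n m (A : pp_system n) (B : 'I_m -> pp_system n) (N : lmodType R^c) :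
  sat (avoid_formula A B) (0 : 'rV[N]_0) <-> forall a : 'I_m -> 'rV[N]_n,
    exists2 b, pp_subgroup A b & forall i, ~ pp_subgroup (B i) (b - a i).
Proof.
have E (a : 'I_m -> 'rV[N]_n) (b : 'rV[N]_n) i :
  \row_j (b 0 j - mxvec (\matrix_i a i) 0 (mxvec_index i j)) = b - a i.
  by apply/rowP => j; rewrite mxE mxvecE !mxE.
pose e (a : 'rV[N]_(m * n)) (b : 'rV[N]_n) := row_mx b (row_mx a (0 : 'rV[N]_0)).
have Eb a b : \row_j (e a b) 0 (lshift _ j) = b by apply/rowP => j; rewrite mxE row_mxEl.
have Ea a b i : \row_j (e (mxvec (\matrix_i a i)) b 0 (lshift _ j) -
    e (mxvec (\matrix_i a i)) b 0 (rshift n (lshift 0 (mxvec_index i j)))) = b - a i.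
  by rewrite -[RHS]E; apply/rowP => j; rewrite mxE [RHS]mxE /e row_mxEl row_mxEr row_mxEl.
rewrite /avoid_formula /=; split.
  rewrite sat_FExs => /forallNP H a; have /= /contrapT := H (mxvec (\matrix_i a i)).
  rewrite sat_FExs => -[b [/sat_pp_formula Ab /sat_FAnds Bb]]; exists b.
    by move: Ab => /=; rewrite Eb.
  by move=> i; have := Bb i; rewrite /= sat_pp_formula /= Ea.
move=> H; rewrite sat_FExs => -[a /= []]; rewrite sat_FExs.
have [b Ab Bb] := H (fun i => row i (vec_mx a)); exists b => /=; split.
  by apply/sat_pp_formula; rewrite Eb.
apply/sat_FAnds => i /=; rewrite sat_pp_formula /=.
have /= := Ea (fun i => row i (vec_mx a)) b i.
have -> : \matrix_i row i (vec_mx a) = vec_mx a by apply/row_matrixP => k; rewrite rowK.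
by rewrite vec_mxK => ->.
Qed.

End Formulas.

(** * Avoiding cosets in the direct sum *)

Section Copower.
Variables (R : pzRingType) (M : lmodType R^c).
Let N := countable_copower M.

Definition copower_proj (k : nat) (x : N) : M := val x k.

Lemma copower_proj_linear k : linear (copower_proj k).
Proof. by []. Qed.

HB.instance Definition _ k := GRing.isLinear.Build R^c N M _ _ (copower_proj_linear k).

Definition delta_fun (k : nat) (d : M) (i : nat) : M := if i == k then d else 0.

Lemma delta_fun_supported k d : delta_fun k d \in @fin_supported R^c M.
Proof.
apply/asboolP; apply: (sub_finite_set _ (finite_set1 k)) => i /=.
by rewrite /delta_fun; case: eqP.
Qed.

Definition copower_inj k (d : M) : N := exist _ (delta_fun k d) (delta_fun_supported k d).

Lemma copower_inj_linear k : linear (copower_inj k).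
Proof.
move=> a x y; apply: val_inj; apply/funext => i.
change (delta_fun k (a *: x + y) i = a *: delta_fun k x i + delta_fun k y i); rewrite /delta_fun.
by case: (i == k); rewrite // scaler0 addr0.
Qed.

HB.instance Definition _ k := GRing.isLinear.Build R^c M N _ _ (copower_inj_linear k).

Lemma copower_projK i k d : copower_proj i (copower_inj k d) = if i == k then d else 0.
Proof. by []. Qed.

Lemma copower_bounded (x : N) : exists b, forall k, (b <= k)%N -> copower_proj k x = 0.
Proof.
have /asboolP/finite_seqP[s sE] := valP x.
exists (\max_(i <- s) i.+1)%N => k hk; apply: contrapT => xk.
have ks : k \in s by have : [set i | val x i <> 0] k by []; rewrite sE.
have : (k.+1 <= \max_(i <- s) i.+1)%N by apply: (leq_bigmax_seq k).
by move=> /leq_trans/(_ hk); rewrite ltnn.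
Qed.

Lemma copower_bounded_fin (I : finType) (x : I -> N) :
  exists b, forall i k, (b <= k)%N -> copower_proj k (x i) = 0.
Proof.
pose b i := projT1 (cid (copower_bounded (x i))).
exists (\max_i b i)%N => i k hk;
apply: (projT2 (cid (copower_bounded (x i)))); apply: leq_trans hk.
exact: (leq_bigmax (F := fun i => projT1 (cid (copower_bounded (x i))))).
Qed.

Lemma copower_avoid n m (A : pp_system R n) (B : 'I_m -> pp_system R n) :
  (forall i, exists2 d : 'rV[M]_n, pp_subgroup A d & ~ pp_subgroup (B i) d) ->
  forall a : 'I_m -> 'rV[N]_n,
    exists2 b, pp_subgroup A b & forall i, ~ pp_subgroup (B i) (b - a i).
Proof.
move=> AB a; pose d i := projT1 (cid2 (AB i)).
have Ad i : pp_subgroup A (d i) by rewrite /d; case: cid2.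
have Bd i : ~ pp_subgroup (B i) (d i) by rewrite /d; case: cid2.
(* All the [a i] vanish from coordinate [K] on; [d i] is placed in coordinate [K + i]. *)
have [K Ka] := copower_bounded_fin (fun p : 'I_m * 'I_n => a p.1 0 p.2).
exists (\sum_(i < m) map_mx (copower_inj (K + i)) (d i)).
  apply: (big_ind (@pp_subgroup _ _ A N)) => [|x y|i _].
  - exact: pp_subgroup0.
  - exact: pp_subgroupD.
  - exact: pp_subgroup_map.
move=> i Bi; apply: (Bd i).
(* Linear maps preserve pp-subgroups, and the projection to coordinate [K + i] sends [b - a i] to
   [d i]. *)
have := pp_subgroup_map (copower_proj (K + i)) Bi.
rewrite (_ : map_mx _ _ = d i) //; apply/rowP => j; rewrite !mxE raddfB /=.
rewrite (Ka (i, j)) ?leq_addr // subr0 summxE raddf_sum /= (bigD1 i) //=.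
rewrite !mxE copower_projK eqxx big1 ?addr0 // => l li.
by rewrite mxE copower_projK eqn_add2l; case: eqP => // /ord_inj il; rewrite il eqxx in li.
Qed.

End Copower.

(** * Cosets of pp-subgroups and the covering property *)

Section Cosets.
Variables (R : pzRingType) (M : lmodType R^c).

Lemma pp_definableE n (X : set 'rV[M]_n) : pp_definable X -> exists (h : pp_system R n) c,
  X = [set x | exists y, rmul x (ps_coef h) + rmul y (ps_wcoef h) + c = 0].
Proof.
move=> [m [t [r [s [c ->]]]]]; exists (PpSystem r s), c.
apply/seteqP; split=> x /= [y h]; exists y.
  by apply/rowP => i; rewrite !mxE h.
by move=> i; have /rowP/(_ i) := h; rewrite !mxE.
Qed.

(** Two solutions of one inhomogeneous system differ by a solution of the homogeneous one. *)
Lemma pp_coset n (X : set 'rV[M]_n) : pp_definable X -> exists h : pp_system R n,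
  forall p x, X p -> X x <-> pp_subgroup h (x - p).
Proof.
move=> /pp_definableE[h [c ->]]; exists h => p x [u hu]; split=> [[v hv]|[v hv]].
  exists (v - u); rewrite !rmulD !rmulN addrACA -opprD.
  by apply/eqP; rewrite subr_eq0 -(inj_eq (addIr c)) hu hv.
exists (v + u); rewrite -[x in rmul x _](subrK p) (rmulD (x - p)) (rmulD v).
by rewrite addrACA hv add0r.
Qed.

Lemma pp_malcev n (X : set 'rV[M]_n) x y z : pp_definable X ->
  X x -> X y -> X z -> X (x - y + z).
Proof.
move=> /pp_coset[h hX] Xx Xy Xz; apply/(hX z) => //.
by rewrite addrK; apply/(hX y).
Qed.

Lemma pp_definable_definable n (X : set 'rV[M]_n) : pp_definable X -> definable X.
Proof.
move=> /pp_definableE[h [c ->]].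
pose h' := PpSystem (col_mx (ps_coef h) 1%:M) (ps_wcoef h).
exists (ps_eqs h), (pp_formula h' (@TVar R _)), c.
apply/seteqP; split=> x /=; rewrite sat_pp_formula /pp_subgroup /=;
  rewrite (_ : \row_j _ = row_mx x c); try by apply/rowP => j; rewrite mxE.
  by rewrite rmul_col_mx1 => -[y hy]; exists y; rewrite addrAC.
by rewrite rmul_col_mx1 => -[y hy]; exists y; rewrite addrAC.
Qed.

Hypothesis hM : elementarily_equivalent M (countable_copower M).

Lemma pp_avoid n m (A : pp_system R n) (B : 'I_m -> pp_system R n) :
  (forall i, exists2 d : 'rV[M]_n, pp_subgroup A d & ~ pp_subgroup (B i) d) ->
  forall a : 'I_m -> 'rV[M]_n,
    exists2 b, pp_subgroup A b & forall i, ~ pp_subgroup (B i) (b - a i).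
Proof. by move=> /copower_avoid/sat_avoid_formula/hM/sat_avoid_formula. Qed.

(** The covering property in contrapositive form: [P] is translated to a subgroup, and [pp_avoid] is
    applied to the cosets that meet [P]. *)
Lemma pp_cover n (P : set 'rV[M]_n) (s : seq (set 'rV[M]_n)) :
  pp_definable P -> P !=set0 -> (forall Q, Q \in s -> pp_definable Q) ->
  (forall Q, Q \in s -> ~ P `<=` Q) ->
  exists2 x, P x & forall Q, Q \in s -> ~ Q x.
Proof.
move=> dP [p Pp] ds Ps; have [A hA] := pp_coset dP.
(* Members of [s] disjoint from [P] have no base point in [P], and they exclude no point of it. *)
pose t := [seq Q <- s | `[< P `&` Q !=set0 >]].
pose Q (i : 'I_(size t)) := nth set0 t i.
have Qt i : Q i \in t by exact: mem_nth.
have Qs i : Q i \in s by have := Qt i; rewrite mem_filter => /andP[].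
have QP i : exists q, P q /\ Q i q.
  by have := Qt i; rewrite mem_filter => /andP[/asboolP].
pose q i := projT1 (cid (QP i)).
have Pq i : P (q i) by rewrite /q; case: cid => ? [].
have Qq i : Q i (q i) by rewrite /q; case: cid => ? [].
pose B i := projT1 (cid (pp_coset (ds _ (Qs i)))).
have BP i : forall p x, Q i p -> Q i x <-> pp_subgroup (B i) (x - p).
  by rewrite /B; case: cid.
have AB i : exists2 d : 'rV[M]_n, pp_subgroup A d & ~ pp_subgroup (B i) d.
  have [y Py Qy] : exists2 y, P y & ~ Q i y.
    apply: contrapT => h; apply: (Ps _ (Qs i)) => y Py.
    by apply: contrapT => Qy; apply: h; exists y.
  exists (y - q i); first by apply/hA.
  by move=> /(BP i _ _ (Qq i)).
(* Translation by [- p] turns [P] into [A] and the coset [q i + B i] into [(q i - p) + B i]. *)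
have [b Ab Bb] := pp_avoid AB (fun i => q i - p).
have Pb : P (b + p) by apply/(hA p) => //; rewrite addrK.
exists (b + p) => // Z Zs Zb; have Zt : Z \in t.
  by rewrite mem_filter Zs andbT; apply/asboolP; exists (b + p).
have it : (index Z t < size t)%N by rewrite index_mem.
have ZQ : Z = Q (Ordinal it) by rewrite /Q nth_index.
apply: (Bb (Ordinal it)); rewrite ZQ in Zb.
by rewrite opprB addrA; exact: (BP _ _ _ (Qq _)).1 Zb.
Qed.

End Cosets.

(** * Formal integral combinations *)

Section Combinations.

Definition ind T (X : set T) (v : T) : int := (`[< X v >] : bool)%:R.

Lemma indP T (X : set T) v : X v -> ind X v = 1.
Proof. by move=> Xv; rewrite /ind asboolT. Qed.

Lemma indN T (X : set T) v : ~ X v -> ind X v = 0.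
Proof. by move=> Xv; rewrite /ind asboolF. Qed.

Lemma indI T (X Y : set T) v : ind (X `&` Y) v = ind X v * ind Y v.
Proof. by rewrite /ind asbool_and; do 2 case: asboolP => _. Qed.

(** The list [s] is a formal integral combination in which points may repeat and coefficients may
    vanish; it is evaluated under the additive extension of [phi]. *)
Definition zcomb (T : Type) (G : zmodType) (s : seq (int * T)) (phi : T -> G) : G :=
  \sum_(p <- s) phi p.2 *~ p.1.

Lemma zcomb_nil T (G : zmodType) (phi : T -> G) : zcomb [::] phi = 0.
Proof. exact: big_nil. Qed.

Lemma zcomb_cons T (G : zmodType) p (s : seq (int * T)) (phi : T -> G) :
  zcomb (p :: s) phi = phi p.2 *~ p.1 + zcomb s phi.
Proof. exact: big_cons. Qed.

Lemma zcomb_cat T (G : zmodType) (s t : seq (int * T)) (phi : T -> G) :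
  zcomb (s ++ t) phi = zcomb s phi + zcomb t phi.
Proof. exact: big_cat. Qed.

Definition zcomb_neg T (s : seq (int * T)) : seq (int * T) := [seq (- p.1, p.2) | p <- s].

Lemma zcomb_negE T (G : zmodType) (s : seq (int * T)) (phi : T -> G) :
  zcomb (zcomb_neg s) phi = - zcomb s phi.
Proof. by rewrite /zcomb big_map -sumrN; apply: eq_bigr => p _; rewrite mulrNz. Qed.

Lemma zcomb_map T U (G : zmodType) (h : T -> U) (s : seq (int * T)) (phi : U -> G) :
  zcomb [seq (p.1, h p.2) | p <- s] phi = zcomb s (phi \o h).
Proof. by rewrite /zcomb big_map. Qed.

Lemma eq_zcomb (T : eqType) (G : zmodType) (s : seq (int * T)) (phi psi : T -> G) :
  (forall p, p \in s -> phi p.2 = psi p.2) -> zcomb s phi = zcomb s psi.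
Proof. by move=> h; apply: eq_big_seq => p ps; rewrite h. Qed.

Lemma zcomb_morph T (G H : zmodType) (f : {additive G -> H}) (s : seq (int * T)) (phi : T -> G) :
  f (zcomb s phi) = zcomb s (f \o phi).
Proof. by rewrite raddf_sum; apply: eq_bigr => p _; rewrite raddfMz. Qed.

Lemma zcomb_exchange T U (G : zmodType) (s : seq (int * T)) (t : seq U) (phi : T -> U -> G) :
  zcomb s (fun x => \sum_(y <- t) phi x y) = \sum_(y <- t) zcomb s (phi^~ y).
Proof.
rewrite /zcomb exchange_big; apply: eq_bigr => p _ /=.
exact: mulrz_suml.
Qed.

Section Reduction.
Variables (T : eqType) (keep : pred T).

Definition coef (s : seq (int * T)) (x : T) : int := \sum_(p <- s | p.2 == x) p.1.

Lemma zcomb_coef (G : zmodType) (s : seq (int * T)) (phi : T -> G) :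
  zcomb s phi = \sum_(x <- undup (unzip2 s)) phi x *~ coef s x.
Proof.
transitivity (\sum_(p <- s) \sum_(x <- undup (unzip2 s)) if p.2 == x then phi x *~ p.1 else 0).
  apply: eq_big_seq => p ps; rewrite (bigD1_seq p.2) ?undup_uniq //=; last first.
    by rewrite mem_undup; exact: map_f.
  by rewrite eqxx big1 ?addr0 // => x /negbTE; rewrite eq_sym => ->.
rewrite exchange_big; apply: eq_bigr => x _ /=.
by rewrite -big_mkcond /coef [RHS]mulrz_sumr.
Qed.

(** Like terms are collected, and those with coefficient 0 or outside [keep] are dropped. Below,
    [keep] is nonemptiness: the empty set has indicator 0 and must go before independence can
    hold. *)
Definition reduce (s : seq (int * T)) : seq (int * T) :=
  [seq (coef s x, x) | x <- undup (unzip2 s) & keep x && (coef s x != 0)].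

Lemma unzip2_reduce s :
  unzip2 (reduce s) = [seq x <- undup (unzip2 s) | keep x && (coef s x != 0)].
Proof. by rewrite /reduce /unzip2 -map_comp map_id. Qed.

Lemma reduce_uniq s : uniq (unzip2 (reduce s)).
Proof. by rewrite unzip2_reduce filter_uniq ?undup_uniq. Qed.

Lemma mem_reduce s p : p \in reduce s -> [/\ keep p.2, p.1 != 0 & p.1 = coef s p.2].
Proof. by move=> /mapP[x]; rewrite mem_filter => /andP[/andP[kx cx] _] ->. Qed.

Lemma zcomb_reduce (G : zmodType) (s : seq (int * T)) (phi : T -> G) :
  (forall x, ~~ keep x -> phi x = 0) -> zcomb (reduce s) phi = zcomb s phi.
Proof.
move=> phi0; rewrite [RHS]zcomb_coef /zcomb /reduce big_map big_filter /=.
rewrite [RHS](bigID (fun x => keep x && (coef s x != 0))) /=.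
rewrite [X in _ + X]big1 ?addr0 // => x; rewrite negb_and negbK => /orP[/phi0->|/eqP->].
  by rewrite mul0rz.
by rewrite mulr0z.
Qed.

End Reduction.

Lemma uniq_unzip2_inj (A T : eqType) (s : seq (A * T)) a b x :
  uniq (unzip2 s) -> (a, x) \in s -> (b, x) \in s -> a = b.
Proof.
elim: s => [|[c y] s IH] //= /andP[ys us]; rewrite !inE.
case/predU1P=> [[-> ->]|ax] /predU1P[[//]|bx].
- by move: ys; rewrite (map_f snd bx).
- by move=> ? xy; move: ys; rewrite -xy (map_f snd ax).
- exact: IH.
Qed.

End Combinations.

(** * Integral combinations of indicators of pp-sets *)

Section PpCombinations.
Variables (R : pzRingType) (M : lmodType R^c).

Definition ppsub n := {X : set 'rV[M]_n | `[< pp_definable X >]}.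
HB.instance Definition _ n := SubChoice.on (ppsub n).

Definition mkpp n (X : set 'rV[M]_n) (dX : pp_definable X) : ppsub n :=
  exist _ X (asboolT dX).

Lemma ppsubP n (P : ppsub n) : pp_definable (val P).
Proof. exact/asboolP/(valP P). Qed.

Definition inhabited n (P : ppsub n) : bool := `[< val P !=set0 >].

Definition fval n (s : seq (int * ppsub n)) (v : 'rV[M]_n) : int :=
  zcomb s (fun P => ind (val P) v).

Lemma fval_reduce n (s : seq (int * ppsub n)) v :
  fval (reduce (@inhabited n) s) v = fval s v.
Proof.
apply: zcomb_reduce => P /asboolP P0; apply: indN => Pv; apply: P0.
by exists v.
Qed.

Lemma fval_cap n (s : seq (int * ppsub n)) (F : set 'rV[M]_n) v :
  zcomb s (fun P => ind (val P `&` F) v) = ind F v * fval s v.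
Proof.
rewrite /fval /zcomb mulr_sumr; apply: eq_bigr => q _.
by rewrite indI !mulrzz mulrA; congr (_ * _); exact: mulrC.
Qed.

(** A maximal summand is contained in no other one, which is what [fval_peak] asks for. *)
Lemma ex_maximal n (l : seq (ppsub n)) (P : ppsub n) : exists Q, [/\ Q \in P :: l,
  val P `<=` val Q & forall Q', Q' \in l -> val Q `<=` val Q' -> Q' = Q].
Proof.
elim: l P => [|A l IH] P; first by exists P; split; rewrite ?inE ?eqxx.
have [Q [Ql PQ Qmax]] := IH P.
have [[QA AQ]|h] := pselect (val Q `<=` val A /\ A <> Q); last first.
  exists Q; split=> //.
    by move: Ql; rewrite !inE => /orP[->|->]; rewrite ?orbT.
  move=> Q'; rewrite inE => /predU1P[->|/Qmax//] QA; apply: contrapT => AQ.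
  exact: h.
have [Q2 [Q2l AQ2 Q2max]] := IH A; exists Q2; split.
- by rewrite inE Q2l orbT.
- by move=> x /PQ/QA/AQ2.
- move=> Q'; rewrite inE => /predU1P[->|/Q2max//] Q2A; apply: val_inj.
  exact/seteqP.
Qed.

(** With [lshift] or [rshift] as [f], this is the projection to a block of coordinates. *)
Definition coords n p (f : 'I_n -> 'I_p) (v : 'rV[M]_p) : 'rV[M]_n := \row_i v 0 (f i).

Lemma coordsE n p (f : 'I_n -> 'I_p) v i : coords f v 0 i = v 0 (f i).
Proof. exact: mxE. Qed.

Lemma coordsB n p (f : 'I_n -> 'I_p) u v : coords f (u - v) = coords f u - coords f v.
Proof. by apply/rowP => i; rewrite !mxE. Qed.

Lemma coordsD n p (f : 'I_n -> 'I_p) u v : coords f (u + v) = coords f u + coords f v.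
Proof. by apply/rowP => i; rewrite !mxE. Qed.

Lemma cc_image (D : forall n, set 'rV[M]_n -> Prop) (Dc : closed_class D)
    n p (f : 'I_n -> 'I_p) (X : set 'rV[M]_p) : D p X -> D n (coords f @` X).
Proof.
move=> dX.
have d : D (n + p)%N [set w | X (rsubmx w) /\ coords f (rsubmx w) = lsubmx w].
  apply: (cc_and Dc); first exact: (cc_rsub Dc).
  apply: (cc_eqv Dc (f := fun i => rshift n (f i))) (@lsubE _ _ _ _) => v i.
  by rewrite coordsE rsubE.
apply: cc_ext (cc_ex Dc d) => x /=; split.
  by move=> [y []]; rewrite row_mxKl row_mxKr; exists y.
by move=> [y Xy yx]; exists y; rewrite row_mxKl row_mxKr.
Qed.

Lemma pp_fiber n p (f : 'I_n -> 'I_p) x : pp_definable [set v | coords f v = x].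
Proof. exact: (cc_pre (pp_closed M) f (cc_point (pp_closed M) x)). Qed.

Definition ppcap n (P Q : ppsub n) : ppsub n := mkpp (ppI (ppsubP P) (ppsubP Q)).
Definition ppimage n p (f : 'I_n -> 'I_p) (P : ppsub p) : ppsub n :=
  mkpp (cc_image (pp_closed M) f (ppsubP P)).
Definition ppfiber n p (f : 'I_n -> 'I_p) x : ppsub p := mkpp (pp_fiber f x).

(** Equivalent to being a Boolean combination of pp-sets; [rep_definable] thus amounts to
    elimination of quantifiers down to pp-formulas. *)
Definition representable n (X : set 'rV[M]_n) : Prop :=
  exists s : seq (int * ppsub n), forall v, fval s v = ind X v.

Lemma rep_ext n (X Y : set 'rV[M]_n) : (forall v, X v <-> Y v) ->
  representable X -> representable Y.
Proof. by move=> h; rewrite (_ : Y = X)//; apply/seteqP; split=> v /h. Qed.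

Lemma rep_pp n (X : set 'rV[M]_n) : pp_definable X -> representable X.
Proof.
by move=> dX; exists [:: (1, mkpp dX)] => v; rewrite /fval /zcomb big_seq1 mulr1z.
Qed.

Lemma repI n (X Y : set 'rV[M]_n) :
  representable X -> representable Y -> representable (X `&` Y).
Proof.
move=> [s sX] [t tY]; exists [seq (p.1 * q.1, ppcap p.2 q.2) | p <- s, q <- t] => v.
rewrite indI -sX -tY /fval /zcomb big_allpairs_dep mulr_suml; apply: eq_bigr => p _.
rewrite mulr_sumr; apply: eq_bigr => q _ /=.
by rewrite indI !mulrzz mulrACA.
Qed.

Lemma repC n (X : set 'rV[M]_n) : representable X -> representable (~` X).
Proof.
move=> [s sX]; exists ((1, mkpp (ppT M n)) :: zcomb_neg s) => v.
rewrite /fval zcomb_cons mulr1z zcomb_negE -/(fval s v) sX indP //.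
by rewrite /ind asbool_neg; case: asboolP.
Qed.

Lemma repU n (X Y : set 'rV[M]_n) :
  representable X -> representable Y -> representable (X `|` Y).
Proof.
by move=> rX rY; rewrite -[_ `|` _]setCK setCU; apply/repC/repI; exact: repC.
Qed.

Lemma rep_bigU n (I : eqType) (l : seq I) (X : I -> set 'rV[M]_n) :
  (forall i, representable (X i)) -> representable [set v | exists2 i, i \in l & X i v].
Proof.
move=> rX; elim: l => [|i l IH].
  by apply: rep_ext (repC (rep_pp (ppT M n))) => v /=; split=> [h|[]//]; case: h.
apply: rep_ext (repU (rX i) IH) => v; split.
  by move=> [Xi|[j jl Xj]]; [exists i|exists j]; rewrite ?inE ?eqxx ?jl ?orbT.
by move=> [j]; rewrite inE => /predU1P[->|jl] Xj; [left|right; exists j].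
Qed.

(** Split along the first summand [P]: on [P] its coefficient is added to the constant [c], outside
    [P] it disappears. *)
Lemma rep_neq0 n (s : seq (int * ppsub n)) (c : int) : representable [set v | fval s v + c <> 0].
Proof.
elim: s c => [|[a P] s IH] c.
  have [->|c0] := eqVneq c 0.
    apply: rep_ext (repC (rep_pp (ppT M n))) => v /=.
    by rewrite /fval /zcomb big_nil addr0; split=> // h; case: h.
  apply: rep_ext (rep_pp (ppT M n)) => v /=.
  by rewrite /fval /zcomb big_nil add0r; split=> // _; exact/eqP.
have rP := rep_pp (ppsubP P).
apply: rep_ext (repU (repI rP (IH (c + a))) (repI (repC rP) (IH c))) => v /=.
have E : fval ((a, P) :: s) v = ind (val P) v *~ a + fval s v.
  by rewrite /fval /zcomb big_cons.
have [Pv|Pv] := pselect (val P v); rewrite E ?(indP Pv) ?(indN Pv).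
  rewrite mulrzz mul1r [a + _]addrC -addrA [a + c]addrC; split=> [[[]|[]]//|]; by left.
by rewrite mul0rz add0r; split=> [[[]|[]]//|]; right.
Qed.

Hypothesis hM : elementarily_equivalent M (countable_copower M).

(* [Y] cannot be covered by [Zs] and the members of [s] other than [P], so it has
   a point at which the whole combination takes the value [c] *)
Lemma fval_peak n (s : seq (int * ppsub n)) c P (Y : set 'rV[M]_n) (Zs : seq (ppsub n)) :
  uniq (unzip2 s) -> (c, P) \in s ->
  pp_definable Y -> Y !=set0 -> Y `<=` val P ->
  (forall Z, Z \in Zs -> ~ Y `<=` val Z) ->
  (forall Q, Q \in unzip2 s -> Q != P -> ~ Y `<=` val Q) ->
  exists2 v, Y v & (forall Z, Z \in Zs -> ~ val Z v) /\ fval s v = c.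
Proof.
move=> us sP dY Y0 YP YZ Ys.
have [||v Yv hv] := @pp_cover _ _ hM _ Y
    (map val Zs ++ [seq val Q | Q <- unzip2 s & Q != P]) dY Y0.
- move=> Q; rewrite mem_cat => /orP[]/mapP[Q' _ ->]; exact: ppsubP.
- move=> Q; rewrite mem_cat => /orP[]/mapP[Q' Q'in ->]; first exact: YZ.
  by move: Q'in; rewrite mem_filter => /andP[? ?]; exact: Ys.
exists v => //; split.
  by move=> Z Zin; apply: hv; rewrite mem_cat map_f.
have u : uniq s := map_uniq us.
rewrite /fval /zcomb (bigD1_seq (c, P)) //= indP ?mulrzz ?mul1r; last exact: YP.
rewrite big_seq_cond big1 ?addr0 // => -[a Q] /andP[/= Qs QP]; rewrite indN ?mul0rz //.
apply: hv; rewrite mem_cat; apply/orP; right; apply: map_f.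
rewrite mem_filter (map_f snd Qs) andbT; apply: contraNneq QP => QP.
by rewrite QP in Qs *; rewrite (uniq_unzip2_inj us Qs sP).
Qed.

End PpCombinations.

(** * Linear independence and elimination of quantifiers *)

Section Independence.
Variables (R : pzRingType) (M : lmodType R^c).
Hypothesis hM : elementarily_equivalent M (countable_copower M).

(** A summand maximal for inclusion has a point outside all the others, and there the combination
    would take the nonzero coefficient of that summand. *)
Lemma fval0_reduce n (s : seq (int * ppsub M n)) : (forall v, fval s v = 0) ->
  reduce (@inhabited R M n) s = [::].
Proof.
move=> s0; have us := reduce_uniq (@inhabited R M n) s.
have := @mem_reduce _ (@inhabited R M n) s.
have : forall v, fval (reduce (@inhabited R M n) s) v = 0.
  by move=> v; rewrite fval_reduce.
case: (reduce _ s) us => // -[c P] t us f0 mt; exfalso.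
have [Q [Ql _ Qmax]] := ex_maximal (unzip2 ((c, P) :: t)) P.
have {}Ql : Q \in unzip2 ((c, P) :: t).
  by move: Ql; rewrite inE => /predU1P[->|//]; rewrite inE eqxx.
have [[d Q'] Qt /= QQ'] := mapP Ql; subst Q'.
have [/asboolP Q0 d0 _] := mt _ Qt.
have [|//|Q' Q'l QQ QQ'|v _ [_]] := fval_peak hM (Zs := [::]) us Qt (ppsubP Q) Q0.
- by [].
- by move: QQ; rewrite (Qmax _ Q'l QQ') eqxx.
- by rewrite f0 => d0'; rewrite -d0' eqxx in d0.
Qed.

Lemma zcomb_eq0 n (G : zmodType) (s : seq (int * ppsub M n)) (phi : ppsub M n -> G) :
  (forall P, ~~ inhabited P -> phi P = 0) -> (forall v, fval s v = 0) -> zcomb s phi = 0.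
Proof. by move=> phi0 s0; rewrite -(zcomb_reduce s phi0) fval0_reduce ?zcomb_nil. Qed.

(** By independence the value depends only on the function that the combination defines; this makes
    [meas] well defined. *)
Lemma zcomb_fval n (G : zmodType) (s t : seq (int * ppsub M n)) (phi : ppsub M n -> G) :
  (forall P, ~~ inhabited P -> phi P = 0) -> (forall v, fval s v = fval t v) ->
  zcomb s phi = zcomb t phi.
Proof.
move=> phi0 st; apply/eqP; rewrite -subr_eq0 -zcomb_negE -zcomb_cat; apply/eqP.
apply: zcomb_eq0 => // v.
by rewrite /fval zcomb_cat zcomb_negE; apply/eqP; rewrite subr_eq0; apply/eqP/st.
Qed.

Lemma fval0_coef n (s : seq (int * ppsub M n)) : (forall v, fval s v = 0) <->
  forall P, P \in unzip2 s -> inhabited P -> coef s P = 0.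
Proof.
split=> [/fval0_reduce s0 P Ps iP|h v].
  apply/eqP; apply: contrapT => /negP cP.
  have : P \in unzip2 (reduce (@inhabited R M n) s).
    by rewrite unzip2_reduce mem_filter iP cP mem_undup.
  by rewrite s0.
rewrite /fval zcomb_coef big_seq big1 // => P; rewrite mem_undup => Ps.
have [iP|/asboolP nP] := boolP (inhabited P); first by rewrite h ?mulr0z.
by rewrite indN ?mul0rz // => Pv; apply: nP; exists v.
Qed.

Section Image.
Variables (n p : nat) (f : 'I_n -> 'I_p).
Let fib (P : ppsub M p) (x : 'rV[M]_n) := ppcap P (ppfiber f x).

(* Nonempty fibres of [P] are cosets of one fixed group. *)
Lemma fiber_eq (P Q : ppsub M p) x x' v : inhabited (fib P x) -> fib P x = fib Q x ->
  val P v -> val Q v -> coords f v = x' -> fib P x' = fib Q x'.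
Proof.
suff H (P' Q' : ppsub M p) : inhabited (fib P' x) -> fib P' x = fib Q' x ->
  val P' v -> val Q' v -> coords f v = x' -> val (fib P' x') `<=` val (fib Q' x').
  move=> iP PQ Pv Qv vx; apply: val_inj; apply/seteqP; split; apply: H => //.
  by rewrite -PQ.
move=> /asboolP[a [Pa ax]] PQ Pv Qv vx u [Pu ux]; split=> //.
have QPx : val (fib Q' x) = val (fib P' x) by rewrite PQ.
have Qa : val Q' a by have [] : val (fib Q' x) a by rewrite QPx.
(* [u - v + a] lies over [x], so the common fibre there carries it from [P'] into [Q']; exchanging
   [a] for [v] inside [Q'] then gives [u]. *)
have Qw : val Q' (u - v + a).
  have : val (fib Q' x) (u - v + a).
    rewrite QPx; split; first exact: pp_malcev (ppsubP P') _ _ _.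
    by rewrite /= coordsD coordsB [coords f u]ux vx subrr add0r.
  by case.
have := pp_malcev (ppsubP Q') Qw Qa Qv.
by rewrite addrK subrK.
Qed.

(* By independence, the fibre of X over x is empty iff the coefficients of the
   summands with a common nonempty fibre over x add up to 0, for every such fibre.
   By [fiber_eq], Q can share its fibre with P only if it is [good] for P, and it
   then does so exactly over the projection of Q `&` P. *)
Lemma rep_image (X : set 'rV[M]_p) : representable X -> representable (coords f @` X).
Proof.
move=> [s sX].
pose good (P Q : ppsub M p) := `[< exists2 x, inhabited (fib P x) & fib P x = fib Q x >].
pose t P := [seq (q.1, ppimage f (ppcap q.2 P)) | q <- s & good P q.2].
apply: rep_ext (rep_bigU (unzip2 s) (fun P =>
  repI (rep_pp (ppsubP (ppimage f P))) (rep_neq0 (t P) 0))) => x.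
(* [sx] represents the fibre of [X] over [x]. *)
pose sx := [seq (q.1, fib q.2 x) | q <- s].
have sxE v : fval sx v = ind (val (ppfiber f x)) v * fval s v.
  by rewrite /fval (zcomb_map (fun Q => fib Q x)); exact: fval_cap.
(* The coefficient of a nonempty fibre over [x] is the value at [x] of a combination [t P] that does
   not depend on [x]. *)
have key P : inhabited (fib P x) -> coef sx (fib P x) = fval (t P) x.
  move=> iP; rewrite /coef big_map /fval (zcomb_map (fun Q => ppimage f (ppcap Q P))) /zcomb big_filter /=.
  rewrite [LHS]big_mkcond [RHS]big_mkcond; apply: eq_bigr => q _ /=.
  have [/asboolP[x' iPx' Px']|/asboolP ng] := boolP (good P q.2); last first.
    by case: eqP => // qP; case: ng; exists x.
  have [im|im] := pselect ((coords f @` (val (ppcap q.2 P))) x).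
    rewrite (indP im); case: im => v [qv Pv] vx.
    by rewrite (fiber_eq iPx' Px' Pv qv vx) eqxx mulrzz mul1r.
  rewrite (indN im) mul0rz; case: eqP => // qP; case: im.
  have /asboolP[v [Pv vx]] := iP; exists v => //; split=> //.
  have : val (fib P x) v by split.
  by rewrite -qP => -[].
rewrite /setI /=; split.
  move=> [P Ps [/= im t0]]; rewrite addr0 in t0.
  have iP : inhabited (fib P x).
    by case: im => v Pv vx; apply/asboolP; exists v.
  apply: contrapT => nX; apply: t0; rewrite -(key _ iP).
  have /fval0_coef : forall v, fval sx v = 0.
    move=> v; rewrite sxE sX; have [vx|vx] := pselect (val (ppfiber f x) v).
      by rewrite (indN (X := X)) ?mulr0 // => Xv; apply: nX; exists v.
    by rewrite indN ?mul0r.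
  apply=> //; have /mapP[q qs ->] := Ps.
  by apply/mapP; exists (q.1, fib q.2 x) => //; apply/mapP; exists q.
move=> [v Xv vx]; apply: contrapT => nP.
have : fval sx v = 0.
  move: v {Xv vx}; apply/fval0_coef => _ /mapP[_ /mapP[q qs ->] ->] /= iq.
  rewrite key //; apply: contrapT => tq; apply: nP; exists q.2; first exact: map_f.
  split; last by rewrite addr0.
  by have /asboolP[v [qv vx]] := iq; exists v.
by rewrite sxE sX !indP.
Qed.

End Image.

Lemma eval_rmul n (t : term R n) : exists r : 'M[R]_(n, 1), forall v : 'rV[M]_n,
  eval v t = rmul v r 0 0.
Proof.
elim: t => [i||s [r hr] t [r' hr']|t [r hr]|t [r hr] a] /=.
- exists (delta_mx i 0) => v; rewrite mxE (bigD1 i) //= big1 ?addr0 => [|j ji].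
    by rewrite mxE !eqxx rscale1.
  by rewrite mxE (negbTE ji) rscale0.
- by exists 0 => v; rewrite mxE big1 // => j _; rewrite mxE rscale0.
- exists (r + r') => v; rewrite hr hr' !mxE -big_split; apply: eq_bigr => j _ /=.
  by rewrite mxE rscaleDr.
- exists (- r) => v; rewrite hr !mxE -sumrN; apply: eq_bigr => j _ /=.
  by rewrite mxE /rscale -scaleNr.
- exists (\matrix_(j, k) (r j k * a)) => v; rewrite hr !mxE /rscale scaler_sumr.
  by apply: eq_bigr => j _; rewrite mxE scalerA.
Qed.

(** Atomic formulas are linear equations, hence pp, and the connectives act on indicators.
    Independence enters only in the existential case, which is a coordinate projection. *)
Lemma rep_sat n (phi : formula R n) : representable [set v : 'rV[M]_n | sat phi v].
Proof.
elim: n / phi => [n s t|n phi IH|n phi IH psi IH'|n phi IH] /=.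
- have [[r hr] [r' hr']] := (eval_rmul s, eval_rmul t).
  apply: rep_pp; exists 0%N, 1%N, (r - r'), 0, 0.
  apply/seteqP; split=> v /=; rewrite hr hr'.
    move=> h; exists 0 => i; rewrite big_ord0 addr0 !mxE addr0 ord1.
    move/eqP: h; rewrite -subr_eq0 !mxE -sumrB => /eqP h; rewrite -[RHS]h.
    by apply: eq_bigr => j _; rewrite !mxE /rscale scalerBl.
  move=> [y /(_ 0)]; rewrite big_ord0 addr0 !mxE addr0 => h.
  apply/eqP; rewrite -subr_eq0 -sumrB -[X in _ == X]h; apply/eqP.
  by apply: eq_bigr => j _; rewrite !mxE /rscale scalerBl.
- exact: repC.
- exact: repI.
- apply: rep_ext (rep_image (@rshift 1 n) IH) => v /=; split.
    move=> [w hw <-]; exists (w 0 (lshift n (0 : 'I_1))).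
    rewrite [row_mx _ _](_ : _ = w) //; apply/rowP => i; rewrite mxE.
    case: splitP => j /= ij; rewrite !mxE; congr (w 0 _); apply/val_inj => //=.
    by rewrite ij ord1.
  move=> [a h]; exists (row_mx (const_mx a : 'rV_1) v) => //.
  by apply/rowP => i; rewrite coordsE row_mxEr.
Qed.

(** Parameters are removed by fixing their coordinates to [c] and projecting these away. *)
Lemma rep_definable n (X : set 'rV[M]_n) : definable X -> representable X.
Proof.
move=> [k [phi [c ->]]].
have rI := repI (rep_sat phi) (rep_pp (pp_fiber (@rshift n k) c)).
apply: rep_ext (rep_image (@lshift n k) rI) => x /=; split.
  move=> [w [/= hw wc] <-]; rewrite [row_mx _ _](_ : _ = w) //.
  rewrite -wc -[RHS]hsubmxK; congr row_mx; apply/rowP => i; rewrite !mxE //.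
move=> h; exists (row_mx x c); first split=> //=;
  by apply/rowP => i; rewrite coordsE ?row_mxEl ?row_mxEr.
Qed.

End Independence.

(** * The colour-valued measure on definable sets *)

Lemma sum_ind (T : eqType) (A : set T) (Y : seq T) : uniq Y ->
  (forall u v, A u -> A v -> u = v) -> (forall u, A u -> u \in Y) ->
  \sum_(y <- Y) ind A y = (`[< A !=set0 >] : bool)%:R.
Proof.
move=> uY A1 AY; case: asboolP => [[u Au]|A0].
  rewrite (bigD1_seq u) ?AY //= indP // big1 ?addr0 // => v vu.
  by apply: indN => Av; case/eqP: vu; exact: A1.
by rewrite big1 // => y _; apply: indN => Ay; apply: A0; exists y.
Qed.

Section PpClass.
Variables (R : pzRingType) (M : lmodType R^c).
Local Notation Z_colours := {malg int[colour M]}.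

(** The basis element of the monoid ring given by the colour of [P]. It is 0 for empty [P], as
    [zcomb_fval] requires, and in dimension 0, which [ppset] excludes. *)
Definition pp_class n (P : ppsub M n) : Z_colours :=
  match pselect (0 < n)%N, pselect (val P !=set0) with
  | left n_gt0, left P0 => << colour_of (PpSet n_gt0 P0 (ppsubP P)) >>
  | _, _ => 0
  end.

Lemma pp_class0 n (P : ppsub M n) : ~~ inhabited P -> pp_class P = 0.
Proof.
by move=> /asboolP P0; rewrite /pp_class; case: pselect => // n0; case: pselect.
Qed.

Lemma pp_classE n (P : ppsub M n) (Q : ppset M) : (0 < n)%N ->
  isomorphic_in (@pp_definable R M) (val P) Q -> pp_class P = << colour_of Q >>.
Proof.
move=> n0 PQ; have P0 : val P !=set0.
  case: PQ => g [[_ _ gs] _]; have [y Qy] := pp_carrier_neq0 Q.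
  by have [x Px _] := gs y Qy; exists x.
rewrite /pp_class; case: pselect => // n0'; case: pselect => // P0'.
by congr << _ >>; apply/colour_ofP.
Qed.

Lemma pp_class_iso n m (P : ppsub M n) (Q : ppsub M m) : (0 < n)%N -> (0 < m)%N ->
  isomorphic_in (@pp_definable R M) (val P) (val Q) -> pp_class P = pp_class Q.
Proof.
move=> n0 m0 PQ; have [/asboolP Q0|nQ] := boolP (inhabited Q).
  have QQ := iso_refl (pp_closed M) (ppsubP Q).
  by rewrite (@pp_classE m Q (PpSet m0 Q0 (ppsubP Q))) //
    (@pp_classE n P (PpSet m0 Q0 (ppsubP Q))).
rewrite !pp_class0 //; apply: contraNN nQ => /asboolP[x Px]; apply/asboolP.
by case: PQ => g [[gt _ _] _]; exists (g x); exact: gt.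
Qed.

Definition ppprodsub n m (P : ppsub M n) (Q : ppsub M m) : ppsub M (n + m) :=
  mkpp (cc_product (pp_closed M) (ppsubP P) (ppsubP Q)).

Lemma pp_class_prod n m (P : ppsub M n) (Q : ppsub M m) : (0 < n)%N -> (0 < m)%N ->
  pp_class (ppprodsub P Q) = pp_class P * pp_class Q.
Proof.
move=> n0 m0; have nm0 : (0 < n + m)%N by rewrite addn_gt0 n0.
have [/asboolP P0|nP] := boolP (inhabited P); last first.
  rewrite (pp_class0 nP) mul0r pp_class0 //; apply: contraNN nP.
  by move=> /asboolP[x [Px _]]; apply/asboolP; exists (lsubmx x).
have [/asboolP Q0|nQ] := boolP (inhabited Q); last first.
  rewrite (pp_class0 nQ) mulr0 pp_class0 //; apply: contraNN nQ.
  by move=> /asboolP[x [_ Qx]]; apply/asboolP; exists (rsubmx x).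
pose P' := PpSet n0 P0 (ppsubP P); pose Q' := PpSet m0 Q0 (ppsubP Q).
rewrite (@pp_classE _ P P') //; last exact: (iso_refl (pp_closed M) (ppsubP P)).
rewrite (@pp_classE _ Q Q') //; last exact: (iso_refl (pp_closed M) (ppsubP Q)).
rewrite (@pp_classE _ _ (ppprod P' Q')) //; last first.
  exact: (iso_refl (pp_closed M) (ppsubP (ppprodsub P Q))).
by rewrite malgM_def fgmulUU mulr1 -colour_mulE.
Qed.

(** The graph is cut out by membership in [X] and equalities of coordinates, so it is a pp-set. *)
Lemma iso_image n p (f : 'I_n -> 'I_p) (X : set 'rV[M]_p) : pp_definable X ->
  (forall u v, X u -> X v -> coords f u = coords f v -> u = v) ->
  isomorphic_in (@pp_definable R M) X (coords f @` X).
Proof.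
move=> dX fI; apply/isoP.
exists (fun u x => X u /\ coords f u = x); split.
- apply: (cc_and (pp_closed M)); first exact: (cc_lsub (pp_closed M)).
  apply: (cc_eqv (pp_closed M) (f := fun i => lshift n (f i))) (@rsubE _ _ _ _) => v i.
  by rewrite coordsE lsubE.
- by move=> u x [Xu <-]; split=> //; exists u.
- by split=> [u Xu|x [u Xu ux]]; [exists (coords f u)|exists u].
- by move=> u x x' [_ <-] [].
- by move=> u u' x [Xu <-] [Xu' /esym]; exact: fI.
Qed.

Hypothesis hM : elementarily_equivalent M (countable_copower M).

(* the additive extension of P |-> [[P]] from pp-sets to definable sets *)
Definition meas n (X : set 'rV[M]_n) : Z_colours :=
  match pselect (representable X) with
  | left rX => zcomb (projT1 (cid rX)) (@pp_class n)
  | right _ => 0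
  end.

Lemma measE n (X : set 'rV[M]_n) s : (forall v, fval s v = ind X v) ->
  meas X = zcomb s (@pp_class n).
Proof.
move=> sX; rewrite /meas; case: pselect => [rX|[]]; last by exists s.
case: cid => t tX /=; apply: (zcomb_fval hM); first exact: pp_class0.
by move=> v; rewrite tX sX.
Qed.

Lemma meas_pp n (P : ppsub M n) : meas (val P) = pp_class P.
Proof.
by rewrite (@measE _ _ [:: (1, P)]) => [|v]; rewrite /fval /zcomb big_seq1 mulr1z.
Qed.

Lemma meas_sum n (I : finType) (X : set 'rV[M]_n) (Y : I -> set 'rV[M]_n) :
  (forall i, representable (Y i)) -> (forall v, ind X v = \sum_i ind (Y i) v) ->
  meas X = \sum_i meas (Y i).
Proof.
move=> rY XY; pose s i := projT1 (cid (rY i)).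
have sP i v : fval (s i) v = ind (Y i) v by rewrite /s; case: cid.
have evs (G : zmodType) (phi : ppsub M n -> G) :
    zcomb (flatten [seq s i | i <- index_enum I]) phi = \sum_i zcomb (s i) phi.
  elim: (index_enum I) => [|i l IH]; first by rewrite big_nil zcomb_nil.
  by rewrite big_cons /= zcomb_cat IH.
rewrite (measE (s := flatten [seq s i | i <- index_enum I])) => [|v].
  by rewrite evs; apply: eq_bigr => i _; rewrite (measE (sP i)).
by rewrite XY /fval evs; apply: eq_bigr => i _; exact: sP.
Qed.

Section Image.
Variables (n p : nat) (f : 'I_n -> 'I_p) (X : set 'rV[M]_p).
Hypothesis fX : forall u v, X u -> X v -> coords f u = coords f v -> u = v.
Variable s : seq (int * ppsub M p).
Hypotheses (sX : forall v, fval s v = ind X v) (us : uniq (unzip2 s))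
  (s0 : forall q, q \in s -> inhabited q.2 /\ q.1 != 0).

(* If f were not injective on a maximal P in s, then the fibre of P through a
   point w of P outside the others would contain a second such point, and both
   would lie in X. *)
Lemma summand_inj P : P \in unzip2 s ->
  forall u v, val P u -> val P v -> coords f u = coords f v -> u = v.
Proof.
move=> Ps u v Pu Pv uv; apply: contrapT => nuv.
have [Q [Qs PQ Qmax]] := ex_maximal (unzip2 s) P.
have {}Qs : Q \in unzip2 s by move: Qs; rewrite inE => /predU1P[->|].
have [[d Q'] dQ /= QQ'] := mapP Qs; subst Q'.
have [/asboolP Q0 d0] := s0 dQ.
have sub Q' : Q' \in unzip2 s -> Q' != Q -> ~ val Q `<=` val Q'.
  by move=> Q's /eqP QQ' h; apply: QQ'; exact: Qmax.
have Xd w : fval s w = d -> X w.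
  by move=> wd; apply: contrapT => Xw; move: d0; rewrite -wd sX indN ?eqxx.
have [|w Qw [wo /Xd Xw]] := fval_peak hM (Zs := [seq Q' <- unzip2 s | Q' != Q])
    us dQ (ppsubP Q) Q0 (fun _ => id) _ sub.
  by move=> Z; rewrite mem_filter => /andP[ZQ Zs]; exact: sub.
have dY := ppI (ppsubP Q) (pp_fiber f (coords f w)).
have [| |Z|Q' Q's Q'Q h|w' [Qw' ww'] [w'o /Xd Xw']] :=
    fval_peak hM (Zs := [:: mkpp (cc_point (pp_closed M) w)]) us dQ dY.
- by exists w.
- by move=> x [].
(* The translate [u - v + w] lies in the fibre of [Q] through [w]; if that fibre were the single
   point [w], then [u = v]. *)
- rewrite inE => /eqP -> /(_ (u - v + w)) h; apply: nuv.
  have /eqP : u - v + w = w.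
    apply: h; split; first exact: pp_malcev (ppsubP Q) (PQ _ Pu) (PQ _ Pv) Qw.
    by rewrite /= coordsD coordsB uv subrr add0r.
  by rewrite -subr_eq0 addrK subr_eq0 => /eqP.
- by apply: (wo Q'); [rewrite mem_filter Q'Q|apply: h].
- by apply: (w'o (mkpp (cc_point (pp_closed M) w))); [rewrite inE eqxx|apply: fX].
Qed.

(** Every summand is projected injectively, so the indicator of its image at [x] is the sum of its
    own indicator over the fibre above [x]. Exchanging the sums reduces the claim to [sX]. *)
Lemma fval_image x :
  fval [seq (q.1, ppimage f q.2) | q <- s] x = ind (coords f @` X) x.
Proof.
pose F : set 'rV[M]_p := [set v | coords f v = x].
have imE (P : set 'rV[M]_p) : (coords f @` P) x <-> P `&` F !=set0.
  by split=> [[v Pv vx]|[v [Pv vx]]]; exists v.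
pose wit (P : set 'rV[M]_p) := xget 0 (P `&` F).
(* A finite list with the unique point of each nonempty fibre, for [X] and all summands. An empty
   fibre contributes the default 0 of [xget], where its own indicator vanishes. *)
pose Y := undup (wit X :: [seq wit (val P) | P <- unzip2 s]).
have sumY (P : set 'rV[M]_p) : (forall u v, P u -> P v -> coords f u = coords f v -> u = v) ->
    wit P \in Y -> \sum_(y <- Y) ind (P `&` F) y = ind (coords f @` P) x.
  move=> fP wY; have F1 u v : (P `&` F) u -> (P `&` F) v -> u = v.
    by move=> [Pu ux] [Pv vx]; apply: fP => //; rewrite [LHS]ux [RHS]vx.
  rewrite sum_ind ?undup_uniq //; first by rewrite /ind (asbool_equiv_eq (imE P)).
  move=> u uF; rewrite (F1 u (wit P)) //; exact: xgetI uF.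
rewrite /fval (zcomb_map (ppimage f)).
rewrite (@eq_zcomb _ _ _ _ (fun P => \sum_(y <- Y) ind (val P `&` F) y)); last first.
  move=> q qs /=; have q2s : q.2 \in unzip2 s by exact: map_f.
  rewrite sumY //; first exact: summand_inj.
  by rewrite mem_undup inE (map_f (fun P : ppsub M p => wit (val P)) q2s) orbT.
rewrite zcomb_exchange -sumY //; last by rewrite mem_undup inE eqxx.
by apply: eq_bigr => y _; rewrite fval_cap sX indI mulrC.
Qed.

End Image.

(** By [summand_inj] each pp-set in the reduced combination has the colour of its image, and by
    [fval_image] these images represent the image of [X]. *)
Lemma meas_image n p (f : 'I_n -> 'I_p) (X : set 'rV[M]_p) :
  (0 < n)%N -> (0 < p)%N -> representable X ->
  (forall u v, X u -> X v -> coords f u = coords f v -> u = v) ->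
  meas (coords f @` X) = meas X.
Proof.
move=> n0 p0 [s' s'X] fX; pose s := reduce (@inhabited _ _ _) s'.
have us : uniq (unzip2 s) by exact: reduce_uniq.
have sX v : fval s v = ind X v by rewrite fval_reduce.
have s0 q : q \in s -> inhabited q.2 /\ q.1 != 0 by move=> /mem_reduce[].
rewrite (measE (fval_image fX sX us s0)) (measE sX) (zcomb_map (ppimage f)).
apply: eq_zcomb => q qs /=; apply/esym/pp_class_iso => //=.
apply: iso_image; first exact: ppsubP.
by apply: (summand_inj fX sX us s0); exact: map_f.
Qed.

Lemma meas_prod n m (X : set 'rV[M]_n) (Y : set 'rV[M]_m) : (0 < n)%N -> (0 < m)%N ->
  representable X -> representable Y -> meas (product_set X Y) = meas X * meas Y.
Proof.
move=> n0 m0 [s sX] [t tY].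
(* Used twice: with [pp_class], and with indicators at a fixed point. *)
have E (A : pzRingType) (phi : ppsub M n -> A) (psi : ppsub M m -> A) chi :
    (forall P Q, chi (ppprodsub P Q) = phi P * psi Q) ->
    zcomb [seq (p.1 * q.1, ppprodsub p.2 q.2) | p <- s, q <- t] chi = zcomb s phi * zcomb t psi.
  move=> h; rewrite /zcomb big_allpairs_dep mulr_suml; apply: eq_bigr => p _.
  rewrite mulr_sumr; apply: eq_bigr => q _ /=.
  by rewrite h mulrzAl mulrzAr -mulrzA mulrC.
rewrite (measE sX) (measE tY) -(E _ _ _ (@pp_class (n + m))); last first.
  by move=> P Q; exact: pp_class_prod.
apply: measE => v; rewrite /fval (E _ (fun P => ind (val P) (lsubmx v))
    (fun Q => ind (val Q) (rsubmx v))).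
  rewrite -/(fval s _) -/(fval t _) sX tY /ind /product_set /= asbool_and.
  by do 2 case: asboolP => _.
move=> P Q; rewrite /ind /= /product_set /= asbool_and.
by do 2 case: asboolP => _.
Qed.

End PpClass.

(** * The isomorphism from the Grothendieck ring to the monoid ring *)

Section ClassMeasure.
Variables (R : pzRingType) (M : lmodType R^c).
Hypothesis hM : elementarily_equivalent M (countable_copower M).
Local Notation Z_colours := {malg int[colour M]}.
Let Dc := definable_closed M.

Lemma coords_lshift n m (v : 'rV[M]_(n + m)) : coords (@lshift n m) v = lsubmx v.
Proof. by apply/rowP => i; rewrite !mxE. Qed.

Lemma coords_rshift n m (v : 'rV[M]_(n + m)) : coords (@rshift n m) v = rsubmx v.
Proof. by apply/rowP => i; rewrite !mxE. Qed.

(** The [G j] may live in different dimensions; their injective projections partition [X], so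
    additivity and [meas_image] apply. *)
Lemma meas_pieces n (X : set 'rV[M]_n) (J : finType) (d : J -> nat)
    (G : forall j, set 'rV[M]_(d j)) (f : forall j, 'I_n -> 'I_(d j)) :
  (0 < n)%N -> (forall j, (0 < d j)%N) -> (forall j, definable (G j)) ->
  (forall x, X x <-> exists j v, G j v /\ coords (f j) v = x) ->
  (forall j j' v v', G j v -> G j' v' -> coords (f j) v = coords (f j') v' -> j = j') ->
  (forall j v v', G j v -> G j v' -> coords (f j) v = coords (f j) v' -> v = v') ->
  meas X = \sum_j meas (G j).
Proof.
move=> n0 d0 dG XG Gdisj Ginj.
rewrite (meas_sum hM (Y := fun j => coords (f j) @` G j)).
- apply: eq_bigr => j _; apply: (meas_image hM) => //; last exact: Ginj.
  exact: rep_definable.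
- by move=> j; apply: (rep_definable hM); exact: (cc_image Dc).
move=> x; have [Xx|Xx] := pselect (X x).
  rewrite (indP Xx); have /XG[j [v [Gv vx]]] := Xx.
  rewrite (bigD1 j) //= indP ?big1 ?addr0 //; last by exists v.
  move=> j' /eqP jj'; apply: indN => -[v' Gv' v'x]; apply: jj'.
  by apply: Gdisj Gv' Gv _; rewrite v'x vx.
rewrite (indN Xx) big1 // => j _; apply: indN => -[v Gv vx]; apply: Xx.
by apply/XG; exists j, v.
Qed.

Definition fam_meas (I : finType) (A : I -> defset M) : Z_colours :=
  \sum_i meas (def_carrier (A i)).

(** Each piece of the graph projects injectively to both sides. Summing the measures of the pieces
    over [j] first gives [fam_meas A], over [i] first [fam_meas B]. *)
Lemma fam_meas_iso (I J : finType) (A : I -> defset M) (B : J -> defset M) :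
  family_iso A B -> fam_meas A = fam_meas B.
Proof.
move=> /family_isoP[G [dG GAB [GA GB] Gf Gi]].
transitivity (\sum_i \sum_j meas [set v | G i j (lsubmx v) (rsubmx v)]).
  apply: eq_bigr => i _.
  apply: (@meas_pieces _ _ _ _ _ (fun j => @lshift _ _)) => //.
  - exact: def_dim_gt0.
  - by move=> j; rewrite addn_gt0 def_dim_gt0.
  - move=> x; split=> [/GA[j [y Gxy]]|[j [v []]]].
      exists j, (row_mx x y).
      by rewrite coords_lshift /= row_mxKl row_mxKr.
    by rewrite coords_lshift => /GAB[Av _] <-.
  - move=> j j' v v' Gv Gv'; rewrite !coords_lshift => vv'.
    rewrite /= -vv' in Gv'; exact: (projT1_eq (Gf _ _ _ _ _ _ Gv Gv')).
  - move=> j v v' Gv Gv'; rewrite !coords_lshift => vv'.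
    rewrite /= -vv' in Gv'; have E := Gf _ _ _ _ _ _ Gv Gv'.
    rewrite -[v]hsubmxK -[v']hsubmxK vv'.
    by rewrite (eq_from_Tagged (E :
      Tagged (fun j => 'rV[M]_(def_dim (B j))) (rsubmx v) = Tagged _ (rsubmx v'))).
rewrite exchange_big; apply: eq_bigr => j _; apply/esym.
apply: (@meas_pieces _ _ _ _ _ (fun i => @rshift _ _)) => //.
- exact: def_dim_gt0.
- by move=> i; rewrite addn_gt0 def_dim_gt0.
- move=> y; split=> [/GB[i [x Gxy]]|[i [v []]]].
    exists i, (row_mx x y).
    by rewrite coords_rshift /= row_mxKl row_mxKr.
  by rewrite coords_rshift => /GAB[_ Bv] <-.
- move=> i i' v v' Gv Gv'; rewrite !coords_rshift => vv'.
  rewrite /= -vv' in Gv'; exact: (projT1_eq (Gi _ _ _ _ _ _ Gv Gv')).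
- move=> i v v' Gv Gv'; rewrite !coords_rshift => vv'.
  rewrite /= -vv' in Gv'; have E := Gi _ _ _ _ _ _ Gv Gv'.
  rewrite -[v]hsubmxK -[v']hsubmxK vv'.
  by rewrite (eq_from_Tagged (E :
    Tagged (fun i => 'rV[M]_(def_dim (A i))) (lsubmx v) = Tagged _ (lsubmx v'))).
Qed.

Definition class_meas (x : DefClass M) : Z_colours := fam_meas (fam_piece (f := repr x)).

Lemma class_measE (I : finType) (A : I -> defset M) :
  class_meas (class_of_fam A) = fam_meas A.
Proof. exact/fam_meas_iso/repr_cls. Qed.

Lemma class_meas_nmod : nmod_morphism class_meas.
Proof.
split; first by rewrite [0](_ : _ = DefClass_zero M) // class_measE /fam_meas big_ord0.
elim/clsW=> I A; elim/clsW=> J B.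
rewrite [_ + _]DefClass_addE !class_measE /fam_meas big_sumType.
by [].
Qed.

Lemma class_meas_monoid : monoid_morphism class_meas.
Proof.
split.
  rewrite [1](_ : _ = DefClass_one M) // class_measE /fam_meas big_ord1 /=.
  rewrite (meas_pp hM (mkpp (cc_point (pp_closed M) 0))).
  by rewrite (pp_classE (Q := ppsingle M)) //; exact: (iso_refl (pp_closed M) (ppsingle_subproof M)).
elim/clsW=> I A; elim/clsW=> J B.
rewrite [_ * _]DefClass_mulE !class_measE /fam_meas big_distrlr pair_big /=.
apply: eq_bigr => -[i j] _; apply: (meas_prod hM); try exact: def_dim_gt0;
  exact/(rep_definable hM)/def_carrierP.
Qed.

HB.instance Definition _ := GRing.isNmodMorphism.Build _ _ class_meas class_meas_nmod.
HB.instance Definition _ := GRing.isMonoidMorphism.Build _ _ class_meas class_meas_monoid.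

(** Total thanks to the default 0, so that it can serve as the [phi] of [zcomb]. *)
Definition K0_class n (X : set 'rV[M]_n) : K0 M :=
  match pselect (0 < n)%N, pselect (definable X) with
  | left n_gt0, left dX => to_groth (class_of (DefSet n_gt0 dX))
  | _, _ => 0
  end.

Lemma K0_class_iso n (X : set 'rV[M]_n) (A : defset M) : (0 < n)%N -> definable X ->
  isomorphic_in (@definable R M) X A -> K0_class X = to_groth (class_of A).
Proof.
move=> n0 dX XA; rewrite /K0_class; case: pselect => // n0'; case: pselect => // dX'.
by congr to_groth; apply/class_ofP.
Qed.

Lemma K0_classE n (X : set 'rV[M]_n) (n_gt0 : (0 < n)%N) (dX : definable X) :
  K0_class X = to_groth (class_of (DefSet n_gt0 dX)).
Proof. by apply: K0_class_iso => //; exact: (iso_refl Dc). Qed.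

Lemma K0_class0 n : K0_class (@set0 'rV[M]_n) = 0.
Proof.
rewrite /K0_class; case: pselect => // n0; case: pselect => // d0.
by rewrite class_of0 // raddf0.
Qed.

Lemma K0_classU n (X Y : set 'rV[M]_n) : (0 < n)%N -> definable X -> definable Y ->
  X `&` Y = set0 -> K0_class (X `|` Y) = K0_class X + K0_class Y.
Proof.
move=> n0 dX dY XY; rewrite (K0_classE n0 dX) (K0_classE n0 dY) (K0_classE n0 (definableU dX dY)).
by rewrite class_ofU // raddfD.
Qed.

Lemma K0_class_split n (X Y : set 'rV[M]_n) : (0 < n)%N -> definable X -> definable Y ->
  K0_class X = K0_class (X `&` Y) + K0_class (X `&` ~` Y).
Proof.
move=> n0 dX dY; rewrite -K0_classU //; first by rewrite -setIUr setUv setIT.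
- exact: definableI.
- exact/definableI/definableC.
by rewrite setIACA setICr setI0.
Qed.

Lemma ppsub_definable n (P : ppsub M n) : definable (val P).
Proof. exact/pp_definable_definable/ppsubP. Qed.

(** Induction on [s] for all [Z] and [c], cutting [Z] along the first summand [P] with coefficient
    [a]: the remaining combination is constantly [c - a] on the part inside [P] and [c] on the part
    outside. *)
Lemma zcomb_K0_class n (s : seq (int * ppsub M n)) Z (c : int) : (0 < n)%N -> definable Z ->
  (forall v, Z v -> fval s v = c) ->
  zcomb s (fun P => K0_class (val P `&` Z)) = K0_class Z *~ c.
Proof.
move=> n0; elim: s Z c => [|[a P] s IH] Z c dZ Zc.
  rewrite zcomb_nil; have [[v Zv]|Z0] := pselect (Z !=set0).
    by rewrite -(Zc v Zv) /fval zcomb_nil mulr0z.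
  rewrite (_ : Z = set0) ?K0_class0 ?mul0rz //; apply/seteqP; split=> // v Zv.
  by apply: Z0; exists v.
have dP := ppsub_definable P; have dC := definableC dP.
have E Q : K0_class (val (Q : ppsub M n) `&` Z) =
    K0_class (val Q `&` (Z `&` val P)) + K0_class (val Q `&` (Z `&` ~` val P)).
  rewrite (K0_class_split (Y := val P)) ?setIA //; apply: definableI => //.
  exact: ppsub_definable.
have -> : zcomb ((a, P) :: s) (fun Q => K0_class (val Q `&` Z)) = K0_class (Z `&` val P) *~ a +
    (zcomb s (fun Q => K0_class (val Q `&` (Z `&` val P))) +
     zcomb s (fun Q => K0_class (val Q `&` (Z `&` ~` val P)))).
  rewrite zcomb_cons setIC; congr (_ + _); rewrite /zcomb -big_split; apply: eq_bigr => q _ /=.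
  by rewrite E mulrzDl.
have f v : fval ((a, P) :: s) v = ind (val P) v *~ a + fval s v by rewrite /fval zcomb_cons.
rewrite (IH _ (c - a)) ?(IH _ c); [|exact: definableI| |exact: definableI|].
- by rewrite addrA -mulrzDr [a + _]addrC subrK -mulrzDl -K0_class_split.
- by move=> v [Zv Pv]; rewrite -(Zc v Zv) f indN // mul0rz add0r.
- by move=> v [Zv Pv]; rewrite -(Zc v Zv) f indP // mulrzz mul1r addrC addKr.
Qed.

(** The sum of two cases of [zcomb_K0_class]: [X] with constant 1 and its complement with constant
    0. *)
Lemma K0_class_fval n (s : seq (int * ppsub M n)) X : (0 < n)%N -> definable X ->
  (forall v, fval s v = ind X v) -> K0_class X = zcomb s (fun P => K0_class (val P)).
Proof.
move=> n0 dX sX; rewrite -[LHS]addr0 -[LHS]/(K0_class X *~ 1 + 0) -(mulr0z (K0_class (~` X))).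
rewrite -(@zcomb_K0_class _ s X) //; last by move=> v Xv; rewrite sX indP.
rewrite -(@zcomb_K0_class _ s (~` X)) //; first last.
- by move=> v Xv; rewrite sX indN.
- exact: definableC.
rewrite /zcomb -big_split; apply: eq_bigr => q _ /=.
by rewrite -mulrzDl -K0_class_split //; exact: ppsub_definable.
Qed.

Definition K0_colour (k : colour M) : K0 M := K0_class (pp_carrier (repr k)).

Lemma K0_class_colour n (P : ppsub M n) (n_gt0 : (0 < n)%N) (P0 : val P !=set0) :
  K0_class (val P) = K0_colour (colour_of (PpSet n_gt0 P0 (ppsubP P))).
Proof.
set k := colour_of _; rewrite /K0_colour.
have dr := pp_definable_definable (pp_carrierP (repr k)).
rewrite (K0_classE (pp_dim_gt0 (repr k)) dr); apply: K0_class_iso => //.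
  exact: ppsub_definable.
have /colour_ofP[f [fb fg]] : k = colour_of (repr k) by rewrite /colour_of reprK.
by exists f; split=> //; exact: pp_definable_definable.
Qed.

(** Membership in the additive subgroup generated by the classes of nonempty pp-sets. *)
Definition spanned (x : K0 M) : Prop := exists l : seq (int * colour M), x = zcomb l K0_colour.

Lemma spannedD x y : spanned x -> spanned y -> spanned (x + y).
Proof. by move=> [l ->] [l' ->]; exists (l ++ l'); rewrite zcomb_cat. Qed.

Lemma spannedN x : spanned x -> spanned (- x).
Proof. by move=> [l ->]; exists (zcomb_neg l); rewrite zcomb_negE. Qed.

Lemma spanned0 : spanned 0.
Proof. by exists [::]; rewrite zcomb_nil. Qed.

Lemma spanned_K0_class n (X : set 'rV[M]_n) : (0 < n)%N -> definable X -> spanned (K0_class X).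
Proof.
move=> n0 dX; have [s sX] := rep_definable hM dX.
rewrite (K0_class_fval n0 dX sX) /zcomb; apply: (big_ind spanned) => [|x y|[a P] _].
- exact: spanned0.
- exact: spannedD.
have [P0|P0] := pselect (val P !=set0).
  exists [:: (a, colour_of (PpSet n0 P0 (ppsubP P)))].
  by rewrite zcomb_cons zcomb_nil addr0 K0_class_colour.
rewrite [K0_class _](_ : _ = 0) ?mul0rz; first exact: spanned0.
rewrite -(K0_class0 n); congr K0_class; apply/seteqP; split=> // v Pv.
by apply: P0; exists v.
Qed.

Lemma spanned_class (x : DefClass M) : spanned (to_groth x).
Proof.
elim/quotW: x => X; rewrite -cls_pi cls_sum raddf_sum.
apply: (big_ind spanned) => [|x y|i _]; [exact: spanned0|exact: spannedD|].
case: (fam_piece i) => n A n0 dA.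
suff: spanned (K0_class A) by rewrite (K0_classE n0 dA).
exact: spanned_K0_class.
Qed.

Lemma spannedT (x : K0 M) : spanned x.
Proof.
elim/grothW: x => a b; rewrite groth_diffE; apply: spannedD.
  exact: spanned_class.
by apply: spannedN; exact: spanned_class.
Qed.

Lemma class_meas_of (A : defset M) : class_meas (class_of A) = meas (def_carrier A).
Proof. by rewrite class_measE /fam_meas big_ord1. Qed.

Lemma rmorph_K0_colour (g : {rmorphism K0 M -> Z_colours}) :
  (forall x, g (to_groth x) = class_meas x) -> forall k, g (K0_colour k) = << k >>.
Proof.
move=> gE k; have pr := pp_carrierP (repr k).
rewrite /K0_colour (K0_classE (pp_dim_gt0 (repr k)) (pp_definable_definable pr)) gE class_meas_of /=.
rewrite (meas_pp hM (mkpp pr)) (pp_classE (Q := repr k)) ?pp_dim_gt0 //.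
  by rewrite /colour_of reprK.
exact: (iso_refl (pp_closed M)).
Qed.

Lemma K0_iso : exists g : {rmorphism K0 M -> Z_colours}, bijective g.
Proof.
have [g [gE _]] := groth_universal (class_meas : {rmorphism DefClass M -> Z_colours}).
have gk := rmorph_K0_colour gE.
have gev (l : seq (int * colour M)) : g (zcomb l K0_colour) = zcomb l (fun k => << k >>).
  by rewrite (zcomb_morph g); apply: eq_zcomb => p _; exact: gk.
(* A kernel element is a combination of classes of colours; its image is the same combination of
   basis elements of the monoid ring, so all collected coefficients vanish. *)
have ginj : injective g.
  apply: raddf_inj => x; have [l ->] := spannedT x => /(etrans (esym (gev l))) l0.
  rewrite zcomb_coef big1 // => k _.
  suff -> : coef l k = 0 by rewrite mulr0z.
  have : mcoeff k (zcomb l (fun k => << k >>) : Z_colours) = 0 by rewrite l0 mcoeff0.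
  rewrite (zcomb_morph (mcoeff k)) => <-; rewrite /coef /zcomb big_mkcond; apply: eq_bigr => p _ /=.
  by rewrite mcoeffU1; case: eqP => _; rewrite mulrzz ?mul1r ?mul0r.
have gsurj y : exists x, g x = y.
  exists (zcomb [seq (y@_k, k) | k <- finmap.enum_fset (msupp y)] K0_colour).
  rewrite gev /zcomb big_map [RHS]monalgE; apply: eq_bigr => k _ /=.
  by rewrite -raddfMz /= intz.
exists g; exists (fun y => projT1 (cid (gsurj y))) => x; last by case: cid.
by apply: ginj; case: cid.
Qed.

End ClassMeasure.

Theorem theorem4p1p2 (R : pzRingType) (M : lmodType R^c)
    (hM : elementarily_equivalent M (countable_copower M)) :
  (exists f : {rmorphism K0 M -> {malg int[colour M]}}, bijective f) /\
  ((exists x : M, x <> 0) -> (0 : K0 M) <> 1).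
Proof.
have [g gbij] := K0_iso hM; split; first by exists g.
(* Applying [g] moves the equation to the monoid ring, where 0 and 1 differ. *)
move=> _ /(congr1 g); rewrite rmorph0 rmorph1 => /eqP.
by rewrite eq_sym oner_eq0.
Qed.
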